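(* Let $f\in\mathcal{W}(1)$ with logarithmic coefficients $\gamma_1,\gamma_2,\gamma_3$, and let $H_{2,1}(F_f/2)=\gamma_1\gamma_3-\gamma_2^2$. Then $$\left|H_{2,1}\!\left(\frac{F_f}{2}\right)\right|\le\frac{1}{81}.$$ The bound is sharp.
   Context: Let $\mathbb{D}=\{z\in\mathbb{C}:|z|<1\}$ and let $\mathcal{A}$ be the class of holomorphic functions $f$ on $\mathbb{D}$ with $f(0)=0$ and $f'(0)=1$, written $f(z)=z+\sum_{n\ge 2}a_nz^n$. $\mathcal{W}(1)$ is the class of all $f\in\mathcal{A}$ with $\mathrm{Re}\,\{f'(z)+z f''(z)\}>0$ for all $z\in\mathbb{D}$. It is known that every $f\in\mathcal{W}(1)$ is univalent in $\mathbb{D}$. The logarithmic coefficients $\gamma_n$ of $f$ are defined by $F_f(z)=\log\frac{f(z)}{z}=2\sum_{n=1}^\infty\gamma_nz^n$ near $0$ (branch of the logarithm vanishing at $z=0$); in particular $\gamma_1=\frac12a_2$, $\gamma_2=\frac12\left(a_3-\frac12a_2^2\right)$, $\gamma_3=\frac12\left(a_4-a_2a_3+\frac13a_2^3\right)$. The second Hankel determinant of the logarithmic coefficients is $H_{2,1}(F_f/2)=\gamma_1\gamma_3-\gamma_2^2=\frac14\left(a_2a_4-a_3^2+\frac1{12}a_2^4\right)$. The bound being sharp means that equality is attained by some $f\in\mathcal{W}(1)$. *)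

(* Defs.v *)
From Stdlib Require Export Reals.
From Coquelicot Require Export Coquelicot.

Open Scope R_scope.

Definition in_disc (z : C) : Prop := Cmod z < 1.

Definition holomorphic_on_disc (f : C -> C) : Prop :=
  forall z : C, in_disc z -> @ex_derive C_AbsRing C_NormedModule f z.

(* Functions on the disc are total functions on [C]; their values outside the
   disc are irrelevant. *)
Definition class_A (f : C -> C) : Prop :=
  holomorphic_on_disc f /\ f (RtoC 0) = RtoC 0 /\
  C_derive f (RtoC 0) = RtoC 1.

(* [C_derive g z] is the complex derivative of [g] at [z] whenever it exists;
   holomorphy of [f] makes both derivatives below genuine on the disc. *)
Definition class_W1 (f : C -> C) : Prop :=
  class_A f /\
  forall z : C, in_disc z ->
    0 < Re (C_derive f z + z * C_derive (C_derive f) z)%C.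

(* exp (x + i y) = e^x (cos y + i sin y) *)
Definition Cexp (z : C) : C :=
  (exp (Re z) * cos (Im z), exp (Re z) * sin (Im z)).

(* [F] is, on the disc of radius [r], the continuous branch of
   log (f(z)/z) vanishing at 0; the singularity of f(z)/z at 0 is removable,
   with value f'(0) = 1 = exp (F 0) there. *)
Definition is_log_branch (f : C -> C) (r : R) (F : C -> C) : Prop :=
  F (RtoC 0) = RtoC 0 /\
  (forall z : C, Cmod z < r ->
     @continuous C_UniformSpace C_UniformSpace F z) /\
  (forall z : C, z <> RtoC 0 -> Cmod z < r -> Cexp (F z) = (f z / z)%C).

(* F_f(z) = 2 * sum_(n >= 1) gamma_n z^n near 0; the value [gamma 0] plays no
   role. *)
Definition log_coefficients (f : C -> C) (gamma : nat -> C) : Prop :=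
  exists (r : R) (F : C -> C),
    0 < r <= 1 /\ is_log_branch f r F /\
    forall z : C, Cmod z < r ->
      @is_pseries C_AbsRing C_NormedModule
        (fun n => match n with
                  | O => RtoC 0
                  | S _ => (RtoC 2 * gamma n)%C
                  end) z (F z).

(* H_{2,1}(F_f / 2) *)
Definition hankel_2_1 (gamma : nat -> C) : C :=
  (gamma 1%nat * gamma 3%nat - gamma 2%nat * gamma 2%nat)%C.

(* Main.v *)
Require Import Defs.
From Stdlib Require Import Reals Lra Lia Psatz.
From Coquelicot Require Import Coquelicot.
Open Scope R_scope.

(** Let [f] be in W(1) and [p = f' + z f'' = (z f')'], a function with positive real
    part and [p 0 = 1]. If [p = 1 + c1 z + c2 z^2 + ...], then
    [a_n = c_(n-1) / n^2], and comparing coefficients in [f / z = exp F]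
    ([exp_coefficients], [hankel_of_coefficients]) gives
    [4 (g1 g3 - g2^2) = a2 a4 - a3^2 + a2^4 / 12
                      = c1 c3 / 64 - c2^2 / 81 + c1^4 / 3072].
    It remains to bound this functional by 4/81
    ([caratheodory_functional_bound]).

    Positivity of the mean of [p |q|^2] over circles, for polynomials [q] of degree at
    most 3, is a positive semidefinite Toeplitz form in [c1, c2, c3] ([toeplitz]). The
    Cayley transform turns it into contractivity of the triangular Toeplitz matrix
    built from the first coefficients [al, be, de] of [(p - 1) / (z (p + 1))]
    ([schur_contraction]), and one step of Schur's algorithm into
    [|k de + conj al be^2| <= k^2 - |be|^2] with [k = 1 - |al|^2]
    ([schur_bound]). The triangle inequality then reduces the claim to the real
    inequality [real_bound]. Equality occurs for [al = de = 0] and [be = 1], that is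
    for [p = (1 + z^2) / (1 - z^2)] ([hankel_sharp]).

    All this requires the power series of a function that is only assumed to be
    complex differentiable in the disc, without which not even [f''] is known to
    exist. Goursat's bisection argument for rectangles ([goursat]), transported by
    the exponential, shows that the mean of a holomorphic function over circles
    about 0 does not depend on the radius in an annulus ([cmean_annulus]); by
    continuity in the radius this survives one exceptional point of mere continuity
    ([cmean_value]). Applied to the difference quotient of [f] at [z] it yields the
    expansion of [f] in powers of [z] ([cauchy_expansion]); power series are
    differentiated termwise ([is_cderiv_csum]). For the sharpness, a logarithm of [f / z] near 0
    is obtained by integrating the power series of its logarithmic derivative
    ([log_coefficients_exist]). *)

(** * Continuity and complex derivatives *)

(** The distance of a point of [T] to the limit point is abstracted by [dist], so
    that the same limit rules serve functions of a real and of a complex variable. *)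
Definition tends {T : Type} (dist : T -> R) (g : T -> C) (c : C) : Prop :=
  forall eps, 0 < eps -> exists d, 0 < d /\ forall s, dist s < d -> Cmod (g s - c) < eps.

Lemma tends_plus {T : Type} (dist : T -> R) (f g : T -> C) (a b : C) :
  tends dist f a -> tends dist g b -> tends dist (fun s => f s + g s)%C (a + b)%C.
Proof.
intros Hf Hg eps He. destruct (Hf (eps / 2) ltac:(lra)) as [d [Hd H1]].
destruct (Hg (eps / 2) ltac:(lra)) as [e [He' H2]].
exists (Rmin d e). split; [apply Rmin_pos; auto|]. intros s Hs.
specialize (H1 s (Rlt_le_trans _ _ _ Hs (Rmin_l _ _))).
specialize (H2 s (Rlt_le_trans _ _ _ Hs (Rmin_r _ _))).
replace (f s + g s - (a + b))%C with ((f s - a) + (g s - b))%C by ring.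
eapply Rle_lt_trans; [apply Cmod_triangle|lra].
Qed.

Lemma tends_mult {T : Type} (dist : T -> R) (f g : T -> C) (a b : C) :
  tends dist f a -> tends dist g b -> tends dist (fun s => f s * g s)%C (a * b)%C.
Proof.
intros Hf Hg eps He.
set (A := Cmod a + 1). set (B := Cmod b + 1).
assert (HA : 1 <= A) by (unfold A; pose proof (Cmod_ge_0 a); lra).
assert (HB : 1 <= B) by (unfold B; pose proof (Cmod_ge_0 b); lra).
assert (Hp : 0 < eps / (2 * B)) by (apply Rdiv_lt_0_compat; nra).
assert (Hq : 0 < eps / (2 * A)) by (apply Rdiv_lt_0_compat; nra).
destruct (Hf (Rmin 1 (eps / (2 * B)))) as [d [Hd H1]]; [apply Rmin_pos; lra|].
destruct (Hg (eps / (2 * A)) Hq) as [e [He' H2]].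
exists (Rmin d e). split; [apply Rmin_pos; auto|]. intros s Hs.
specialize (H1 s (Rlt_le_trans _ _ _ Hs (Rmin_l _ _))).
specialize (H2 s (Rlt_le_trans _ _ _ Hs (Rmin_r _ _))).
assert (H3 := Rlt_le_trans _ _ _ H1 (Rmin_l _ _)).
assert (H4 := Rlt_le_trans _ _ _ H1 (Rmin_r _ _)).
replace (f s * g s - a * b)%C with (f s * (g s - b) + (f s - a) * b)%C by ring.
eapply Rle_lt_trans; [apply Cmod_triangle|]. rewrite !Cmod_mult.
assert (HfA : Cmod (f s) <= A).
{ unfold A. replace (f s) with ((f s - a) + a)%C by ring.
  eapply Rle_trans; [apply Cmod_triangle|lra]. }
assert (HgB : Cmod b <= B) by (unfold B; lra).
assert (E1 : A * (eps / (2 * A)) = eps / 2) by (field; lra).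
assert (E2 : (eps / (2 * B)) * B = eps / 2) by (field; lra).
pose proof (Cmod_ge_0 (f s)). pose proof (Cmod_ge_0 b).
pose proof (Cmod_ge_0 (g s - b)). pose proof (Cmod_ge_0 (f s - a)).
nra.
Qed.

Definition is_cderiv (f : C -> C) (z l : C) : Prop :=
  @is_derive C_AbsRing C_NormedModule f z l.
Definition ex_cderiv (f : C -> C) (z : C) : Prop := exists l, is_cderiv f z l.
Definition ccont (f : C -> C) (z : C) : Prop :=
  @continuous C_UniformSpace C_UniformSpace f z.

(** The general rules of differentiation for products and compositions concern
    the normed module that an absolute ring is over itself; on [C] it has the
    same norm as [C_NormedModule] but a different uniform structure. *)
Lemma is_cderiv_ring (f : C -> C) (z l : C) :
  is_cderiv f z l <-> @is_derive C_AbsRing (AbsRing_NormedModule C_AbsRing) f z l.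
Proof.
split; intros [[A B D] H2]; (split; [constructor; [exact A|exact B|exact D]|exact H2]).
Qed.

Lemma locally_Cmod (z : C) (P : C -> Prop) :
  @locally C_UniformSpace z P <->
  exists d, 0 < d /\ forall w, Cmod (w - z) < d -> P w.
Proof.
rewrite locally_C. split.
- intros [d Hd]. exists d. split; [apply cond_pos|]. intros w Hw. apply Hd. exact Hw.
- intros [d [Hd H]]. exists (mkposreal d Hd). intros w Hw. apply H. exact Hw.
Qed.

Lemma filterlim_Cmod {T : Type} (F : (T -> Prop) -> Prop) {FF : Filter F}
  (f : T -> C) (l : C) :
  filterlim f F (@locally C_UniformSpace l) <->
  forall eps, 0 < eps -> F (fun x => Cmod (f x - l) < eps).
Proof.
split.
- intros H eps He. apply (H (fun w => Cmod (w - l) < eps)).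
  apply locally_Cmod. exists eps. auto.
- intros H P HP. apply locally_Cmod in HP. destruct HP as [d [Hd HP]].
  unfold filtermap. generalize (H d Hd). apply filter_imp. intros x Hx. apply HP, Hx.
Qed.

Lemma ccont_Cmod (f : C -> C) (z : C) :
  ccont f z <-> forall eps, 0 < eps ->
    exists d, 0 < d /\ forall w, Cmod (w - z) < d -> Cmod (f w - f z) < eps.
Proof.
unfold ccont, continuous. rewrite -> (filterlim_Cmod _ f (f z)).
split; intros H eps He; apply locally_Cmod; apply H; exact He.
Qed.

Lemma is_cderiv_Cmod (f : C -> C) (z l : C) :
  is_cderiv f z l <-> forall eps, 0 < eps -> exists d, 0 < d /\
    forall w, Cmod (w - z) < d -> Cmod (f w - f z - (w - z) * l) <= eps * Cmod (w - z).
Proof.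
split.
- intros [_ H] eps He.
  assert (K : is_filter_lim (@locally (AbsRing_UniformSpace C_AbsRing) z) z) by (intros P HP; exact HP).
  specialize (H z K (mkposreal eps He)).
  destruct H as [d Hd]. exists d. split; [apply cond_pos|]. intros w Hw.
  apply (Hd w Hw).
- intros H. split. apply is_linear_scal_l.
  intros x Hx. assert (E : z = x).
  { apply (is_filter_lim_locally_unique (K:=C_AbsRing) (V:=AbsRing_NormedModule C_AbsRing)). exact Hx. }
  subst x. intros eps. destruct (H eps (cond_pos eps)) as [d [Hd H2]].
  exists (mkposreal d Hd). intros w Hw. apply (H2 w Hw).
Qed.

Lemma ex_cderiv_ccont (f : C -> C) (z : C) : ex_cderiv f z -> ccont f z.
Proof.
intros [l H]. rewrite is_cderiv_Cmod in H. apply ccont_Cmod. intros eps He.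
destruct (H 1 ltac:(lra)) as [d [Hd H1]].
pose proof (Cmod_ge_0 l) as Hl.
assert (Hp : 0 < eps / (Cmod l + 2)) by (apply Rdiv_lt_0_compat; lra).
exists (Rmin d (eps / (Cmod l + 2))). split; [apply Rmin_pos; auto|].
intros w Hw. 
assert (Hw1 := Rlt_le_trans _ _ _ Hw (Rmin_l _ _)).
assert (Hw2 := Rlt_le_trans _ _ _ Hw (Rmin_r _ _)).
specialize (H1 w Hw1).
replace (f w - f z)%C with ((f w - f z - (w - z) * l) + (w - z) * l)%C by ring.
eapply Rle_lt_trans. apply Cmod_triangle. rewrite Cmod_mult.
apply Rmult_lt_compat_r with (r := Cmod l + 2) in Hw2; [|lra].
unfold Rdiv in Hw2. rewrite Rmult_assoc, Rinv_l, Rmult_1_r in Hw2 by lra.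
pose proof (Cmod_ge_0 (w - z)). nra.
Qed.

Lemma is_cderiv_ext_near (f g : C -> C) (z l : C) (d : R) : 0 < d ->
  (forall w, Cmod (w - z) < d -> f w = g w) -> is_cderiv f z l -> is_cderiv g z l.
Proof.
intros Hd H Hf. rewrite is_cderiv_Cmod in *. intros eps He.
destruct (Hf eps He) as [e [Hp H1]]. exists (Rmin d e). split; [apply Rmin_pos; auto|].
intros w Hw. rewrite <- !H.
- apply H1. eapply Rlt_le_trans; [exact Hw|apply Rmin_r].
- replace (z - z)%C with (RtoC 0) by ring. rewrite Cmod_0. exact Hd.
- eapply Rlt_le_trans; [exact Hw|apply Rmin_l].
Qed.

Lemma ccont_ext_near (f g : C -> C) (z : C) (d : R) : 0 < d ->
  (forall w, Cmod (w - z) < d -> f w = g w) -> ccont f z -> ccont g z.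
Proof.
intros Hd H Hf. rewrite ccont_Cmod in *. intros eps He.
destruct (Hf eps He) as [e [Hp H1]]. exists (Rmin d e). split; [apply Rmin_pos; auto|].
intros w Hw. rewrite <- !H.
- apply H1. eapply Rlt_le_trans; [exact Hw|apply Rmin_r].
- replace (z - z)%C with (RtoC 0) by ring. rewrite Cmod_0. exact Hd.
- eapply Rlt_le_trans; [exact Hw|apply Rmin_l].
Qed.

Lemma is_cderiv_const (a z : C) : is_cderiv (fun _ => a) z 0.
Proof. apply is_cderiv_ring. apply (is_derive_const (K:=C_AbsRing) (V:=AbsRing_NormedModule C_AbsRing)). Qed.

Lemma is_cderiv_id (z : C) : is_cderiv (fun w => w) z 1.
Proof. apply is_cderiv_ring. apply (is_derive_id (K:=C_AbsRing)). Qed.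

Lemma is_cderiv_plus (f g : C -> C) (z a b : C) :
  is_cderiv f z a -> is_cderiv g z b -> is_cderiv (fun w => f w + g w)%C z (a + b)%C.
Proof. rewrite !is_cderiv_ring. apply (is_derive_plus (K:=C_AbsRing) (V:=AbsRing_NormedModule C_AbsRing)). Qed.

Lemma is_cderiv_mult (f g : C -> C) (z a b : C) :
  is_cderiv f z a -> is_cderiv g z b ->
  is_cderiv (fun w => f w * g w)%C z (a * g z + f z * b)%C.
Proof. 
rewrite !is_cderiv_ring. intros Hf Hg. apply (is_derive_mult (K:=C_AbsRing)); auto. intros n m. apply Cmult_comm. Qed.

Lemma is_cderiv_opp (f : C -> C) (z a : C) :
  is_cderiv f z a -> is_cderiv (fun w => - f w)%C z (- a)%C.
Proof. rewrite !is_cderiv_ring. apply (is_derive_opp (K:=C_AbsRing) (V:=AbsRing_NormedModule C_AbsRing)). Qed.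

Lemma is_cderiv_minus (f g : C -> C) (z a b : C) :
  is_cderiv f z a -> is_cderiv g z b -> is_cderiv (fun w => f w - g w)%C z (a - b)%C.
Proof. rewrite !is_cderiv_ring. apply (is_derive_minus (K:=C_AbsRing) (V:=AbsRing_NormedModule C_AbsRing)). Qed.

Lemma is_cderiv_comp (f g : C -> C) (z a b : C) :
  is_cderiv f (g z) a -> is_cderiv g z b -> is_cderiv (fun w => f (g w)) z (b * a)%C.
Proof. rewrite !is_cderiv_ring. apply (is_derive_comp (K:=C_AbsRing) (V:=AbsRing_NormedModule C_AbsRing)). Qed.

Lemma is_cderiv_inv (z : C) : z <> 0 -> is_cderiv Cinv z (- / (z * z))%C.
Proof.
intros Hz. rewrite is_cderiv_Cmod. intros eps He.
assert (Hm : 0 < Cmod z) by (apply Cmod_gt_0; auto).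
set (m := Cmod z) in *.
exists (Rmin (m / 2) (eps * (m * m * m) / 2)). split.
{ apply Rmin_pos; [lra|]. apply Rdiv_lt_0_compat; [|lra].  repeat apply Rmult_lt_0_compat; auto. }
intros w Hw.
assert (Hw1 := Rlt_le_trans _ _ _ Hw (Rmin_l _ _)).
assert (Hw2 := Rlt_le_trans _ _ _ Hw (Rmin_r _ _)).
assert (Hmw : m / 2 <= Cmod w).
{ assert (m <= Cmod w + Cmod (w - z)).
  { unfold m. replace z with (w + - (w - z))%C at 1 by ring.
    eapply Rle_trans; [apply Cmod_triangle|]. rewrite Cmod_opp. lra. }
  lra. }
assert (Hw0 : w <> 0). { intros E. rewrite E, Cmod_0 in Hmw. lra. }
replace (/ w - / z - (w - z) * - / (z * z))%C with ((w - z) * ((w - z) * / (w * z * z)))%C by (field; auto).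
rewrite Cmod_mult, Rmult_comm. apply Rmult_le_compat_r; [apply Cmod_ge_0|].
rewrite Cmod_mult, Cmod_inv, !Cmod_mult.
2:{ repeat apply Cmult_neq_0; auto. }
fold m.
assert (Hq : m * m * m / 2 <= Cmod w * m * m) by nra.
assert (0 < m * m * m / 2). { apply Rdiv_lt_0_compat; [|lra].  repeat apply Rmult_lt_0_compat; auto. }
apply Rmult_le_reg_r with (Cmod w * m * m); [lra|].
rewrite Rmult_assoc, Rinv_l, Rmult_1_r by lra. nra.
Qed.

Lemma is_cderiv_div (f g : C -> C) (z a b : C) : g z <> 0 ->
  is_cderiv f z a -> is_cderiv g z b ->
  is_cderiv (fun w => f w / g w)%C z ((a * g z - f z * b) / (g z * g z))%C.
Proof.
intros Hz Hf Hg.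
replace ((a * g z - f z * b) / (g z * g z))%C
  with (a * / g z + f z * (b * (- / (g z * g z))))%C by (field; auto).
apply (is_cderiv_mult f (fun w => / g w)%C); [exact Hf|].
apply (is_cderiv_comp Cinv g); [apply is_cderiv_inv; exact Hz|exact Hg].
Qed.

Lemma is_cderiv_eq (f : C -> C) (z a b : C) : is_cderiv f z a -> a = b -> is_cderiv f z b.
Proof. intros H <-. exact H. Qed.

Lemma is_cderiv_pow (n : nat) (z : C) :
  is_cderiv (fun w => w ^ n)%C z (INR n * z ^ (pred n))%C.
Proof.
induction n as [|n IH].
- apply (is_cderiv_eq _ _ 0); [exact (is_cderiv_const 1 z)|simpl; ring].
- eapply is_cderiv_eq. apply (is_cderiv_mult (fun w => w) (fun w => w ^ n)%C); [apply is_cderiv_id|exact IH].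
  rewrite S_INR, RtoC_plus. destruct n as [|n]; simpl; ring.
Qed.

Lemma ccont_const (c z : C) : ccont (fun _ => c) z.
Proof. apply ex_cderiv_ccont. eexists. apply is_cderiv_const. Qed.

Lemma ccont_id (z : C) : ccont (fun w => w) z.
Proof. apply ex_cderiv_ccont. eexists. apply is_cderiv_id. Qed.

Lemma ccont_plus (f g : C -> C) (z : C) :
  ccont f z -> ccont g z -> ccont (fun w => f w + g w)%C z.
Proof. rewrite !ccont_Cmod. apply tends_plus. Qed.

Lemma ccont_mult (f g : C -> C) (z : C) :
  ccont f z -> ccont g z -> ccont (fun w => f w * g w)%C z.
Proof. rewrite !ccont_Cmod. apply tends_mult. Qed.

Lemma ccont_inv (f : C -> C) (z : C) : ccont f z -> f z <> 0 -> ccont (fun w => / f w)%C z.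
Proof.
intros Hf Hz.
assert (H : ccont Cinv (f z)) by (apply ex_cderiv_ccont; eexists; apply is_cderiv_inv, Hz).
rewrite ccont_Cmod in *. intros eps He. destruct (H eps He) as [d [Hd H1]].
destruct (Hf d Hd) as [e [He2 H2]]. exists e. split; auto.
Qed.

Lemma ccont_pow (n : nat) (z : C) : ccont (fun w => w ^ n)%C z.
Proof. apply ex_cderiv_ccont. eexists. apply is_cderiv_pow. Qed.

(* Higher-order patterns keep unification from unfolding the summands. *)
Ltac ccont_tac := repeat match goal with
  | |- ccont (fun z => Cplus (@?f z) (@?g z)) _ => apply (ccont_plus f g)
  | |- ccont (fun z => Cmult (@?f z) (@?g z)) _ => apply (ccont_mult f g)
  | |- ccont (fun z => z) _ => apply ccont_id
  | |- ccont (fun _ => ?c) _ => apply ccont_const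
  | |- _ => assumption
  end.

Lemma ex_cderiv_plus (f g : C -> C) (z : C) :
  ex_cderiv f z -> ex_cderiv g z -> ex_cderiv (fun w => f w + g w)%C z.
Proof. intros [a Ha] [b Hb]. exists (a + b)%C. apply is_cderiv_plus; auto. Qed.

Lemma ex_cderiv_mult (f g : C -> C) (z : C) :
  ex_cderiv f z -> ex_cderiv g z -> ex_cderiv (fun w => f w * g w)%C z.
Proof. intros [a Ha] [b Hb]. eexists. apply is_cderiv_mult; eauto. Qed.

Lemma ex_cderiv_const (c z : C) : ex_cderiv (fun _ => c) z.
Proof. exists 0. apply is_cderiv_const. Qed.

Lemma ex_cderiv_id (z : C) : ex_cderiv (fun w => w) z.
Proof. exists 1. apply is_cderiv_id. Qed.

Ltac ex_cderiv_tac := repeat match goal with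
  | |- ex_cderiv (fun z => Cplus (@?f z) (@?g z)) _ => apply (ex_cderiv_plus f g)
  | |- ex_cderiv (fun z => Cmult (@?f z) (@?g z)) _ => apply (ex_cderiv_mult f g)
  | |- ex_cderiv (fun z => z) _ => apply ex_cderiv_id
  | |- ex_cderiv (fun _ => ?c) _ => apply ex_cderiv_const
  | |- _ => assumption
  end.

(** * Integrals of complex-valued functions of a real variable *)

Definition pcont (g : R -> C) (t : R) : Prop := tends (fun s => Rabs (s - t)) g (g t).

Definition pcont_on (g : R -> C) (a b : R) : Prop :=
  forall t, a <= t <= b -> pcont g t.

Definition CInt (g : R -> C) (a b : R) : C :=
  (RInt (fun t => Re (g t)) a b, RInt (fun t => Im (g t)) a b).

Lemma im_le_Cmod (c : C) : Rabs (Im c) <= Cmod c.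
Proof. eapply Rle_trans; [apply Rmax_r|apply Rmax_Cmod]. Qed.

Lemma Cmod_le_Re_Im (c : C) : Cmod c <= Rabs (Re c) + Rabs (Im c).
Proof.
replace c with (RtoC (Re c) + Ci * RtoC (Im c))%C at 1.
- eapply Rle_trans; [apply Cmod_triangle|]. rewrite Cmod_mult, Cmod_Ci, !Cmod_R. lra.
- destruct c as [x y]. unfold RtoC, Ci, Cplus, Cmult. simpl. f_equal; ring.
Qed.

Lemma pcont_Re (g : R -> C) (t : R) : pcont g t -> continuous (fun s => Re (g s)) t.
Proof.
intros H. apply (proj2 (filterlim_locally _ _)). intros eps.
destruct (H eps (cond_pos eps)) as [d [Hd H1]]. exists (mkposreal d Hd).
intros s Hs. specialize (H1 s Hs). eapply Rle_lt_trans; [|exact H1].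
apply (re_le_Cmod (g s - g t)).
Qed.

Lemma pcont_Im (g : R -> C) (t : R) : pcont g t -> continuous (fun s => Im (g s)) t.
Proof.
intros H. apply (proj2 (filterlim_locally _ _)). intros eps.
destruct (H eps (cond_pos eps)) as [d [Hd H1]]. exists (mkposreal d Hd).
intros s Hs. specialize (H1 s Hs). eapply Rle_lt_trans; [|exact H1].
apply (im_le_Cmod (g s - g t)).
Qed.

Lemma pcont_comp (G : C -> C) (g : R -> C) (t : R) :
  ccont G (g t) -> pcont g t -> pcont (fun s => G (g s)) t.
Proof.
rewrite ccont_Cmod. intros HG Hg eps He. destruct (HG eps He) as [d [Hd H]].
destruct (Hg d Hd) as [e [He2 H2]]. exists e. split; auto.
Qed.

Lemma pcont_lipschitz (g : R -> C) (t : R) :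
  (forall s, Cmod (g s - g t) <= Rabs (s - t)) -> pcont g t.
Proof.
intros H eps He. exists eps. split; auto. intros s Hs. eapply Rle_lt_trans; eauto.
Qed.

Lemma Cmod_horizontal (x x' y : R) : Cmod ((x, y) - (x', y)) = Rabs (x - x').
Proof.
replace ((x, y) - (x', y))%C with (RtoC (x - x')). apply Cmod_R.
unfold RtoC, Cminus, Cplus, Copp. simpl. f_equal; ring.
Qed.

Lemma Cmod_vertical (x y y' : R) : Cmod ((x, y) - (x, y')) = Rabs (y - y').
Proof.
replace ((x, y) - (x, y'))%C with (Ci * RtoC (y - y'))%C.
rewrite Cmod_mult, Cmod_Ci, Cmod_R. ring.
unfold RtoC, Cminus, Cplus, Copp, Ci, Cmult. simpl. f_equal; ring.
Qed.

Lemma pcont_horizontal (c t : R) : pcont (fun s => (s, c)) t.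
Proof. apply pcont_lipschitz. intros s. rewrite Cmod_horizontal. lra. Qed.

Lemma pcont_vertical (c t : R) : pcont (fun s => (c, s)) t.
Proof. apply pcont_lipschitz. intros s. rewrite Cmod_vertical. lra. Qed.

Lemma pcont_const (c : C) (t : R) : pcont (fun _ => c) t.
Proof.
apply pcont_lipschitz. intros s. replace (c - c)%C with (RtoC 0) by ring.
rewrite Cmod_0. apply Rabs_pos.
Qed.

Lemma pcont_plus (f g : R -> C) (t : R) :
  pcont f t -> pcont g t -> pcont (fun s => f s + g s)%C t.
Proof. apply tends_plus. Qed.

Lemma pcont_mult (f g : R -> C) (t : R) :
  pcont f t -> pcont g t -> pcont (fun s => f s * g s)%C t.
Proof. apply tends_mult. Qed.

Section CIntTheory.
Context (a b : R) (Hab : a <= b).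

Lemma ex_RInt_Re (g : R -> C) : pcont_on g a b -> ex_RInt (fun t => Re (g t)) a b.
Proof.
intros H. apply (ex_RInt_continuous (V := R_CompleteNormedModule)). intros z Hz. rewrite Rmin_left, Rmax_right in Hz by lra.
apply pcont_Re, H, Hz.
Qed.

Lemma ex_RInt_Im (g : R -> C) : pcont_on g a b -> ex_RInt (fun t => Im (g t)) a b.
Proof.
intros H. apply (ex_RInt_continuous (V := R_CompleteNormedModule)). intros z Hz. rewrite Rmin_left, Rmax_right in Hz by lra.
apply pcont_Im, H, Hz.
Qed.

Lemma CInt_ext (f g : R -> C) : (forall t, a <= t <= b -> f t = g t) -> CInt f a b = CInt g a b.
Proof.
intros H. unfold CInt. f_equal; apply RInt_ext; intros x Hx;
rewrite Rmin_left, Rmax_right in Hx by lra; rewrite H; auto; lra.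
Qed.

Lemma CInt_plus (f g : R -> C) : pcont_on f a b -> pcont_on g a b ->
  CInt (fun t => f t + g t)%C a b = (CInt f a b + CInt g a b)%C.
Proof.
intros Hf Hg. unfold CInt, Cplus. simpl. f_equal.
- apply (RInt_plus (V := R_CompleteNormedModule)); apply ex_RInt_Re; auto.
- apply (RInt_plus (V := R_CompleteNormedModule)); apply ex_RInt_Im; auto.
Qed.

Lemma CInt_scal (c : C) (f : R -> C) : pcont_on f a b ->
  CInt (fun t => c * f t)%C a b = (c * CInt f a b)%C.
Proof.
intros Hf. unfold CInt, Cmult. simpl.
assert (H1 := ex_RInt_Re f Hf). assert (H2 := ex_RInt_Im f Hf).
assert (S : forall k g, ex_RInt g a b -> RInt (fun t => k * g t) a b = k * RInt g a b).
{ intros k g Hg. apply (RInt_scal (V := R_CompleteNormedModule)). exact Hg. }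
assert (E : forall k g, ex_RInt g a b -> ex_RInt (fun t => k * g t) a b).
{ intros k g Hg. apply (ex_RInt_scal (V := R_CompleteNormedModule)). exact Hg. }
f_equal.
- rewrite (RInt_minus (V := R_CompleteNormedModule) (fun t => fst c * Re (f t)) (fun t => snd c * Im (f t))) by auto.
  rewrite !S by auto. reflexivity.
- rewrite (RInt_plus (V := R_CompleteNormedModule) (fun t => fst c * Im (f t)) (fun t => snd c * Re (f t))) by auto.
  rewrite !S by auto. reflexivity.
Qed.

Lemma CInt_minus (f g : R -> C) : pcont_on f a b -> pcont_on g a b ->
  CInt (fun t => f t - g t)%C a b = (CInt f a b - CInt g a b)%C.
Proof.
intros Hf Hg. 
rewrite (CInt_ext _ (fun t => f t + (-(1)) * g t)%C) by (intros; ring).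
rewrite CInt_plus, CInt_scal; auto. ring.
intros t Ht. apply pcont_mult; [apply pcont_const|auto].
Qed.

(** The factor 2 comes from bounding the two components separately; only the
    linearity in [M] and in the length matters below. *)
Lemma CInt_le (f : R -> C) (M : R) : pcont_on f a b ->
  (forall t, a <= t <= b -> Cmod (f t) <= M) -> Cmod (CInt f a b) <= 2 * M * (b - a).
Proof.
intros Hf HM.
eapply Rle_trans; [apply Cmod_le_Re_Im|]. simpl.
assert (H1 : Rabs (RInt (fun t => Re (f t)) a b) <= (b - a) * M).
{ apply (norm_RInt_le_const (V := R_CompleteNormedModule) (fun t => Re (f t)) a b); [lra| |apply RInt_correct, ex_RInt_Re, Hf].
  intros x Hx. eapply Rle_trans; [apply re_le_Cmod|apply HM, Hx]. }
assert (H2 : Rabs (RInt (fun t => Im (f t)) a b) <= (b - a) * M).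
{ apply (norm_RInt_le_const (V := R_CompleteNormedModule) (fun t => Im (f t)) a b); [lra| |apply RInt_correct, ex_RInt_Im, Hf].
  intros x Hx. eapply Rle_trans; [apply im_le_Cmod|apply HM, Hx]. }
lra.
Qed.

Lemma CInt_affine (A B : C) :
  CInt (fun t => A + RtoC t * B)%C a b = (RtoC (b - a) * A + RtoC ((b * b - a * a) / 2) * B)%C.
Proof.
assert (K : forall u v : R, RInt (fun t => u + t * v) a b = (b - a) * u + (b * b - a * a) / 2 * v).
{ intros u v. apply is_RInt_unique.
  replace ((b - a) * u + (b * b - a * a) / 2 * v) with (minus (u * b + b * b / 2 * v) (u * a + a * a / 2 * v)) by (unfold minus, plus, opp; simpl; field).
  apply (is_RInt_derive (V := R_CompleteNormedModule) (fun t => u * t + t * t / 2 * v)).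
  - intros x _. auto_derive; auto. field.
  - intros x _. apply (ex_derive_continuous (K:=R_AbsRing) (V:=R_NormedModule)). auto_derive. auto. }
unfold CInt. destruct A as [p q], B as [u v].
rewrite (RInt_ext (fun t : R => Re ((p, q) + t * (u, v))%C) (fun t => p + t * u)) by (intros; simpl; ring).
rewrite (RInt_ext (fun t : R => Im ((p, q) + t * (u, v))%C) (fun t => q + t * v)) by (intros; simpl; ring).
rewrite !K. unfold Cplus, Cmult, RtoC. simpl. f_equal; ring.
Qed.

End CIntTheory.

Lemma CInt_Chasles (f : R -> C) (a b c : R) : a <= b -> b <= c -> pcont_on f a c ->
  (CInt f a b + CInt f b c)%C = CInt f a c.
Proof.
intros H1 H2 Hf. unfold CInt, Cplus. simpl.
assert (F1 : pcont_on f a b) by (intros t Ht; apply Hf; lra).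
assert (F2 : pcont_on f b c) by (intros t Ht; apply Hf; lra).
f_equal; apply (RInt_Chasles (V := R_CompleteNormedModule)); auto using ex_RInt_Re, ex_RInt_Im.
Qed.

(** * Goursat's theorem for rectangles *)

(** The integral of [G z dz] counterclockwise along the boundary of
    [[a, b] x [c, d]]. *)
Definition rect_int (G : C -> C) (a b c d : R) : C :=
  (CInt (fun s => G (s, c)) a b + Ci * CInt (fun t => G (b, t)) c d
   - CInt (fun s => G (s, d)) a b - Ci * CInt (fun t => G (a, t)) c d)%C.

Definition ccont_rect (G : C -> C) (a b c d : R) : Prop :=
  forall s t, a <= s <= b -> c <= t <= d -> ccont G (s, t).

Lemma pcont_on_horizontal (G : C -> C) (a b c d y : R) :
  ccont_rect G a b c d -> c <= y <= d -> pcont_on (fun s => G (s, y)) a b.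
Proof.
intros H Hy s Hs. apply (pcont_comp G (fun s => (s, y))); [apply H; auto|apply pcont_horizontal].
Qed.

Lemma pcont_on_vertical (G : C -> C) (a b c d x : R) :
  ccont_rect G a b c d -> a <= x <= b -> pcont_on (fun t => G (x, t)) c d.
Proof.
intros H Hx t Ht. apply (pcont_comp G (fun t => (x, t))); [apply H; auto|apply pcont_vertical].
Qed.

Lemma ccont_rect_sub (G : C -> C) (a b c d a' b' c' d' : R) :
  ccont_rect G a b c d -> a <= a' -> b' <= b -> c <= c' -> d' <= d -> ccont_rect G a' b' c' d'.
Proof. intros H ? ? ? ? s t Hs Ht. apply H; lra. Qed.

Lemma rect_int_split (G : C -> C) (a m b c n d : R) :
  a <= m <= b -> c <= n <= d -> ccont_rect G a b c d ->
  rect_int G a b c d =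
  (rect_int G a m c n + rect_int G m b c n + rect_int G a m n d + rect_int G m b n d)%C.
Proof.
intros Hm Hn H. unfold rect_int.
assert (Hh : forall y, c <= y <= d -> CInt (fun s => G (s, y)) a b
  = (CInt (fun s => G (s, y)) a m + CInt (fun s => G (s, y)) m b)%C).
{ intros y Hy. symmetry. apply CInt_Chasles; try lra. eapply pcont_on_horizontal; eauto. }
assert (Hv : forall x, a <= x <= b -> CInt (fun s => G (x, s)) c d
  = (CInt (fun s => G (x, s)) c n + CInt (fun s => G (x, s)) n d)%C).
{ intros y Hy. symmetry. apply CInt_Chasles; try lra. eapply pcont_on_vertical; eauto. }
rewrite !Hh, !Hv by lra. ring.
Qed.

Lemma rect_int_minus (F G : C -> C) (a b c d : R) : a <= b -> c <= d ->
  ccont_rect F a b c d -> ccont_rect G a b c d ->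
  rect_int (fun z => F z - G z)%C a b c d = (rect_int F a b c d - rect_int G a b c d)%C.
Proof.
intros Hab Hcd HF HG. unfold rect_int.
rewrite !CInt_minus by (try lra; (eapply pcont_on_horizontal || eapply pcont_on_vertical); eauto; lra).
ring.
Qed.

Lemma rect_int_affine (A B : C) (a b c d : R) : a <= b -> c <= d ->
  rect_int (fun z => A + z * B)%C a b c d = 0.
Proof.
intros Hab Hcd. unfold rect_int.
assert (Hh : forall y, CInt (fun s => A + (s, y) * B)%C a b
  = (RtoC (b - a) * (A + Ci * RtoC y * B) + RtoC ((b * b - a * a) / 2) * B)%C).
{ intros y. rewrite <- CInt_affine by lra. apply CInt_ext; [lra|]. intros t _.
  replace ((t, y) : C) with (RtoC t + Ci * RtoC y)%C. ring.
  unfold RtoC, Ci, Cplus, Cmult. simpl. f_equal; ring. }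
assert (Hv : forall x, CInt (fun t => A + (x, t) * B)%C c d
  = (RtoC (d - c) * (A + RtoC x * B) + RtoC ((d * d - c * c) / 2) * (Ci * B))%C).
{ intros y. rewrite <- CInt_affine by lra. apply CInt_ext; [lra|]. intros t _.
  replace ((y, t) : C) with (RtoC y + Ci * RtoC t)%C. ring.
  unfold RtoC, Ci, Cplus, Cmult. simpl. f_equal; ring. }
rewrite !Hh, !Hv. destruct A as [p q], B as [u v].
unfold RtoC, Ci, Cplus, Cmult, Cminus, Copp. apply injective_projections; simpl; field.
Qed.

Lemma rect_int_le (G : C -> C) (a b c d M : R) : a <= b -> c <= d ->
  ccont_rect G a b c d ->
  (forall s t, a <= s <= b -> c <= t <= d -> Cmod (G (s, t)) <= M) ->
  Cmod (rect_int G a b c d) <= 4 * M * ((b - a) + (d - c)).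
Proof.
intros Hab Hcd HG HM. unfold rect_int.
assert (H1 : Cmod (CInt (fun s => G (s, c)) a b) <= 2 * M * (b - a)).
{ apply CInt_le; [lra|eapply pcont_on_horizontal; eauto; lra|]. intros; apply HM; lra. }
assert (H2 : Cmod (CInt (fun s => G (s, d)) a b) <= 2 * M * (b - a)).
{ apply CInt_le; [lra|eapply pcont_on_horizontal; eauto; lra|]. intros; apply HM; lra. }
assert (H3 : Cmod (CInt (fun s => G (a, s)) c d) <= 2 * M * (d - c)).
{ apply CInt_le; [lra|eapply pcont_on_vertical; eauto; lra|]. intros; apply HM; lra. }
assert (H4 : Cmod (CInt (fun s => G (b, s)) c d) <= 2 * M * (d - c)).
{ apply CInt_le; [lra|eapply pcont_on_vertical; eauto; lra|]. intros; apply HM; lra. }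
unfold Cminus.
eapply Rle_trans; [apply Cmod_triangle|]. rewrite Cmod_opp, Cmod_mult, Cmod_Ci.
eapply Rle_trans; [apply Rplus_le_compat_r; apply Cmod_triangle|]. rewrite Cmod_opp.
eapply Rle_trans; [apply Rplus_le_compat_r; apply Rplus_le_compat_r; apply Cmod_triangle|].
rewrite Cmod_mult, Cmod_Ci. lra.
Qed.

Definition quad : Type := (R * R * R * R)%type.

Definition bisect (I : R -> R -> R -> R -> R) (q : quad) : quad :=
  let '(a, b, c, d) := q in
  let m := (a + b) / 2 in let n := (c + d) / 2 in
  if Rle_dec (I a b c d / 4) (I a m c n) then (a, m, c, n)
  else if Rle_dec (I a b c d / 4) (I m b c n) then (m, b, c, n)
  else if Rle_dec (I a b c d / 4) (I a m n d) then (a, m, n, d)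
  else (m, b, n, d).

Fixpoint bisections (I : R -> R -> R -> R -> R) (q : quad) (n : nat) : quad :=
  match n with O => q | S n => bisect I (bisections I q n) end.

Lemma nested_intervals (a b : nat -> R) :
  (forall n, a n <= a (S n)) -> (forall n, b (S n) <= b n) -> (forall n, a n <= b n) ->
  exists x, forall n, a n <= x <= b n.
Proof.
intros Ha Hb Hab.
assert (Ha' : forall n m, (n <= m)%nat -> a n <= a m).
{ intros n m H. induction H. lra. specialize (Ha m). lra. }
assert (Hb' : forall n m, (n <= m)%nat -> b m <= b n).
{ intros n m H. induction H. lra. specialize (Hb m). lra. }
assert (Hx : forall n m, a n <= b m).
{ intros n m. specialize (Ha' n (Nat.max n m) ltac:(lia)).
  specialize (Hb' m (Nat.max n m) ltac:(lia)). specialize (Hab (Nat.max n m)). lra. }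
destruct (completeness (fun x => exists n, x = a n)) as [x [U L]].
- exists (b O). intros y [n ->]. apply Hx.
- exists (a O). exists O. reflexivity.
- exists x. intros n. split.
  + apply U. exists n. reflexivity.
  + apply L. intros y [m ->]. apply Hx.
Qed.

(** Bisection keeps a quarter of the integral in ever smaller rectangles, while
    near their common point the affine approximation of [G] forces the
    integral to be small compared with the area. *)
Theorem goursat (G : C -> C) (a b c d : R) : a <= b -> c <= d ->
  (forall s t, a <= s <= b -> c <= t <= d -> ex_cderiv G (s, t)) ->
  rect_int G a b c d = 0.
Proof.
intros Hab Hcd HD.
assert (HG : ccont_rect G a b c d) by (intros s t Hs Ht; apply ex_cderiv_ccont, HD; auto).
destruct (Req_dec (Cmod (rect_int G a b c d)) 0) as [H0|H0]; [apply Cmod_eq_0, H0|exfalso].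
set (eta := Cmod (rect_int G a b c d)) in *.
assert (Heta : 0 < eta) by (unfold eta in *; pose proof (Cmod_ge_0 (rect_int G a b c d)); lra).
set (I := fun a b c d => Cmod (rect_int G a b c d)).
set (Q := bisections I (a, b, c, d)).
set (A := fun n => fst (fst (fst (Q n)))). set (B := fun n => snd (fst (fst (Q n)))).
set (E := fun n => snd (fst (Q n))). set (D := fun n => snd (Q n)).
assert (Step : forall n, a <= A n /\ A n <= B n /\ B n <= b /\ c <= E n /\ E n <= D n /\ D n <= d ->
  (A n <= A (S n) /\ B (S n) <= B n /\ E n <= E (S n) /\ D (S n) <= D n) /\
  (B (S n) - A (S n) = (B n - A n) / 2 /\ D (S n) - E (S n) = (D n - E n) / 2) /\
  I (A n) (B n) (E n) (D n) / 4 <= I (A (S n)) (B (S n)) (E (S n)) (D (S n))).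
{ intros n. unfold A, B, E, D. change (Q (S n)) with (bisect I (Q n)).
  destruct (Q n) as [[[a' b'] c'] d']. simpl. intros (H1 & H2 & H3 & H4 & H5 & H6).
  assert (S := rect_int_split G a' ((a' + b') / 2) b' c' ((c' + d') / 2) d'
    ltac:(lra) ltac:(lra) (ccont_rect_sub _ _ _ _ _ _ _ _ _ HG H1 H3 H4 H6)).
  assert (T : I a' b' c' d' <= I a' ((a' + b') / 2) c' ((c' + d') / 2)
    + I ((a' + b') / 2) b' c' ((c' + d') / 2)
    + I a' ((a' + b') / 2) ((c' + d') / 2) d' + I ((a' + b') / 2) b' ((c' + d') / 2) d').
  { unfold I. rewrite S. 
    eapply Rle_trans; [apply Cmod_triangle|apply Rplus_le_compat_r].
    eapply Rle_trans; [apply Cmod_triangle|apply Rplus_le_compat_r].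
    apply Cmod_triangle. }
  repeat destruct Rle_dec; simpl; (split; [repeat split; lra|split; [split; field|lra]]). }
assert (Inv : forall n, (a <= A n /\ A n <= B n /\ B n <= b /\ c <= E n /\ E n <= D n /\ D n <= d) /\
  B n - A n = (b - a) * (/ 2) ^ n /\ D n - E n = (d - c) * (/ 2) ^ n /\
  eta * (/ 2) ^ n * (/ 2) ^ n <= I (A n) (B n) (E n) (D n)).
{ induction n as [|n IH].
  - change (A O) with a. change (B O) with b. change (E O) with c. change (D O) with d.
    change (I a b c d) with eta. simpl. repeat split; lra.
  - destruct IH as (H1 & H2 & H3 & H4). destruct (Step n H1) as (H5 & (H6 & H7) & H8).
    rewrite H2 in H6. rewrite H3 in H7. simpl.
    assert (0 < (/ 2) ^ n) by (apply pow_lt; lra).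
    assert (0 <= (b - a) * (/2) ^ n) by (apply Rmult_le_pos; lra).
    assert (0 <= (d - c) * (/2) ^ n) by (apply Rmult_le_pos; lra).
    repeat split; try lra. }
assert (Step' := fun n => proj1 (Step n (proj1 (Inv n)))).
destruct (nested_intervals A B) as [x Hx]; try (intros n; specialize (Step' n); specialize (Inv n); lra).
destruct (nested_intervals E D) as [y Hy]; try (intros n; specialize (Step' n); specialize (Inv n); lra).
assert (Hx0 : a <= x <= b) by (specialize (Hx O); exact Hx).
assert (Hy0 : c <= y <= d) by (specialize (Hy O); exact Hy).
destruct (HD x y Hx0 Hy0) as [l Hl]. rewrite is_cderiv_Cmod in Hl.
set (P := (b - a) + (d - c)).
assert (HP : 0 <= P) by (unfold P; lra).
(* On a rectangle with half perimeter [P 2^-N] the remainder integrates to at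
   most [4 eps P^2 4^-N]; this [eps] puts it below the lower bound [eta 4^-N]. *)
set (eps := eta / (8 * (P + 1) * (P + 1))).
assert (Heps : 0 < eps) by (apply Rdiv_lt_0_compat; [lra|repeat apply Rmult_lt_0_compat; lra]).
destruct (Hl eps Heps) as [del [Hdel Hd]].
destruct (pow_lt_1_zero (/ 2) ltac:(rewrite Rabs_pos_eq; lra) (del / (P + 1)) ltac:(apply Rdiv_lt_0_compat; lra)) as [N HN].
specialize (HN N (le_n N)).
assert (Hp : 0 < (/ 2) ^ N) by (apply pow_lt; lra).
rewrite Rabs_pos_eq in HN by lra.
set (p := (/ 2) ^ N) in *.
assert (HPp : P * p < del).
{ apply Rmult_lt_compat_l with (r := P + 1) in HN; [|lra].
  replace ((P + 1) * (del / (P + 1))) with del in HN by (field; lra). nra. }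
destruct (Inv N) as ((I1 & I2 & I3 & I4 & I5 & I6) & I7 & I8 & I9). fold p in I7, I8, I9.
specialize (Hx N). specialize (Hy N).
assert (Hnear : forall s t, A N <= s <= B N -> E N <= t <= D N -> Cmod ((s, t) - (x, y)) <= P * p).
{ intros s t Hs Ht. eapply Rle_trans; [apply Cmod_le_Re_Im|]. simpl.
  unfold P. assert (Rabs (s + - x) <= B N - A N) by (apply Rabs_le; lra).
  assert (Rabs (t + - y) <= D N - E N) by (apply Rabs_le; lra). lra. }
assert (Haff : ccont_rect (fun z => G (x, y) - (x, y) * l + z * l)%C (A N) (B N) (E N) (D N)).
{ intros s t _ _. apply ex_cderiv_ccont. eexists.
  apply is_cderiv_plus; [apply (is_cderiv_const _ _)|]. apply is_cderiv_mult; [apply is_cderiv_id|apply is_cderiv_const]. }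
assert (HGN := ccont_rect_sub _ _ _ _ _ _ _ _ _ HG I1 I3 I4 I6).
assert (Bnd : Cmod (rect_int (fun z => G z - (G (x, y) - (x, y) * l + z * l))%C (A N) (B N) (E N) (D N))
  <= 4 * (eps * (P * p)) * ((B N - A N) + (D N - E N))).
{ apply rect_int_le; auto.
  - intros s t Hs Ht. apply ex_cderiv_ccont. destruct (HD s t ltac:(lra) ltac:(lra)) as [g Hg].
    eexists. apply is_cderiv_minus; [exact Hg|].
    apply is_cderiv_plus; [apply (is_cderiv_const _ _)|]. apply is_cderiv_mult; [apply is_cderiv_id|apply is_cderiv_const]. 
  - intros s t Hs Ht. specialize (Hnear s t Hs Ht).
    replace (G (s, t) - (G (x, y) - (x, y) * l + (s, t) * l))%C
      with (G (s, t) - G (x, y) - ((s, t) - (x, y)) * l)%C by ring.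
    eapply Rle_trans; [apply Hd; lra|]. apply Rmult_le_compat_l; lra. }
rewrite rect_int_minus, rect_int_affine in Bnd by auto.
replace (rect_int G (A N) (B N) (E N) (D N) - 0)%C with (rect_int G (A N) (B N) (E N) (D N)) in Bnd by ring.
fold (I (A N) (B N) (E N) (D N)) in Bnd.
rewrite I7, I8 in Bnd.
assert (Bnd2 : eta * p * p <= 4 * eps * (P * P) * (p * p)) by (unfold P in *; lra).
assert (Hpp : 0 < p * p) by nra.
assert (Bnd3 : eta <= 4 * eps * (P * P)) by nra.
assert (Heq : eps * (8 * (P + 1) * (P + 1)) = eta) by (unfold eps; field; lra).
nra.
Qed.

(** * Means over circles *)

Lemma Cexp_plus (z w : C) : Cexp (z + w) = (Cexp z * Cexp w)%C.
Proof.
destruct z as [a b], w as [c d]. unfold Cexp. simpl.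
rewrite exp_plus, cos_plus, sin_plus. apply injective_projections; simpl; ring.
Qed.

Lemma Cexp_0 : Cexp 0 = 1.
Proof. unfold Cexp. simpl. rewrite exp_0, cos_0, sin_0. apply injective_projections; simpl; ring. Qed.

Lemma is_derive_0_error (f : R -> R) (l : R) : is_derive f 0 l ->
  forall eps, 0 < eps -> exists d, 0 < d /\
    forall x, Rabs x < d -> Rabs (f x - f 0 - l * x) <= eps * Rabs x.
Proof.
intros [_ H] eps He.
destruct (H 0 ltac:(intros P HP; exact HP) (mkposreal eps He)) as [d Hd].
exists d. split; [apply cond_pos|]. intros x Hx.
assert (B : ball 0 d x). { unfold ball; simpl. unfold AbsRing_ball, abs, minus, plus, opp; simpl. replace (x + - 0) with x by ring. exact Hx. }
specialize (Hd x B).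
unfold norm, minus, plus, opp, scal in Hd; simpl in Hd.
unfold abs in Hd; simpl in Hd. unfold mult in Hd; simpl in Hd.
replace (x + - 0) with x in Hd by ring.
replace (f x - f 0 - l * x) with (f x + - f 0 + - (x * l)) by ring. exact Hd.
Qed.

Lemma is_cderiv_Cexp_0 : is_cderiv Cexp 0 1.
Proof.
apply is_cderiv_Cmod. intros eps He. rewrite Cexp_0.
set (e := Rmin 1 (eps / 9)).
assert (Hpe : 0 < e) by (apply Rmin_pos; lra).
assert (He1 : e <= 1) by apply Rmin_l. assert (He9 : e <= eps / 9) by apply Rmin_r.
destruct (is_derive_0_error exp 1 ltac:(auto_derive; auto; rewrite exp_0; ring) e Hpe) as [d1 [Hd1 D1]].
destruct (is_derive_0_error cos 0 ltac:(auto_derive; auto; rewrite sin_0; ring) e Hpe) as [d2 [Hd2 D2]].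
destruct (is_derive_0_error sin 1 ltac:(auto_derive; auto; rewrite cos_0; ring) e Hpe) as [d3 [Hd3 D3]].
rewrite exp_0 in D1. rewrite cos_0 in D2. rewrite sin_0 in D3.
exists (Rmin (e / 2) (Rmin d1 (Rmin d2 d3))). split; [repeat apply Rmin_pos; lra|].
intros w Hw.
replace (w - 0)%C with w in * by ring.
assert (Hx := re_le_Cmod w). assert (Hy := im_le_Cmod w).
set (m := Cmod w) in *.
assert (B0 : m < e / 2) by (eapply Rlt_le_trans; [exact Hw|apply Rmin_l]).
assert (B : m < Rmin d1 (Rmin d2 d3)) by (eapply Rlt_le_trans; [exact Hw|apply Rmin_r]).
assert (B1 : m < d1) by (eapply Rlt_le_trans; [exact B|apply Rmin_l]).
assert (B' : m < Rmin d2 d3) by (eapply Rlt_le_trans; [exact B|apply Rmin_r]).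
assert (B2 : m < d2) by (eapply Rlt_le_trans; [exact B'|apply Rmin_l]).
assert (B3 : m < d3) by (eapply Rlt_le_trans; [exact B'|apply Rmin_r]).
assert (Hm : 0 <= m) by apply Cmod_ge_0.
clearbody m. destruct w as [x y]. simpl in Hx, Hy.
specialize (D1 x ltac:(lra)). specialize (D2 y ltac:(lra)). specialize (D3 y ltac:(lra)).
eapply Rle_trans; [apply Cmod_le_Re_Im|]. unfold Cexp. simpl.
apply Rabs_le_between in D1. apply Rabs_le_between in D2. apply Rabs_le_between in D3.
apply Rabs_le_between in Hx. apply Rabs_le_between in Hy.
assert (Kx : Rabs x <= m) by (apply Rabs_le; lra).
assert (Ky : Rabs y <= m) by (apply Rabs_le; lra).
assert (E1 : Rabs (exp x - 1 - x) <= e * m) by (apply Rabs_le; nra).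
assert (E2 : Rabs (cos y - 1) <= e * m) by (apply Rabs_le; nra).
assert (E3 : Rabs (sin y - y) <= e * m) by (apply Rabs_le; nra).
assert (E4 : Rabs (exp x - 1) <= e).
{ replace (exp x - 1) with ((exp x - 1 - x) + x) by ring. eapply Rle_trans; [apply Rabs_triang|]. nra. }
assert (E5 : Rabs (exp x) <= 2).
{ replace (exp x) with ((exp x - 1) + 1) by ring. eapply Rle_trans; [apply Rabs_triang|]. rewrite Rabs_R1. lra. }
replace (exp x * cos y + - (1) + - (x * 1 - y * 0)) with (exp x * (cos y - 1) + (exp x - 1 - x)) by ring.
replace (exp x * sin y + - 0 + - (x * 0 + y * 1)) with (exp x * (sin y - y) + (exp x - 1) * y) by ring.
assert (F1 : Rabs (exp x * (cos y - 1) + (exp x - 1 - x)) <= 3 * e * m).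
{ eapply Rle_trans; [apply Rabs_triang|]. rewrite Rabs_mult.
  pose proof (Rabs_pos (exp x)). pose proof (Rabs_pos (cos y - 1)). nra. }
assert (F2 : Rabs (exp x * (sin y - y) + (exp x - 1) * y) <= 3 * e * m).
{ eapply Rle_trans; [apply Rabs_triang|]. rewrite !Rabs_mult.
  pose proof (Rabs_pos (exp x)). pose proof (Rabs_pos (sin y - y)). pose proof (Rabs_pos y). pose proof (Rabs_pos (exp x - 1)). nra. }
nra.
Qed.

Lemma is_cderiv_Cexp (z : C) : is_cderiv Cexp z (Cexp z).
Proof.
apply (is_cderiv_ext_near (fun w => Cexp z * Cexp (w - z))%C _ z _ 1); [lra| |].
{ intros w _. rewrite <- Cexp_plus. f_equal. ring. }
eapply is_cderiv_eq.
- apply is_cderiv_mult; [apply (is_cderiv_const (Cexp z))|].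
  apply (is_cderiv_comp Cexp (fun w => w - z)%C).
  + replace (z - z)%C with (RtoC 0) by ring. apply is_cderiv_Cexp_0.
  + apply is_cderiv_minus; [apply is_cderiv_id|apply is_cderiv_const].
- simpl. ring.
Qed.

Lemma exp_mono (x y : R) : x <= y -> exp x <= exp y.
Proof. intros [H| ->]; [left; apply exp_increasing, H|apply Rle_refl]. Qed.

Definition circ (r t : R) : C := (r * cos t, r * sin t).

Lemma circ_Cexp (r t : R) : circ r t = (r * Cexp (0, t))%C.
Proof. unfold circ, Cexp. simpl. rewrite exp_0. apply injective_projections; simpl; ring. Qed.

Lemma circ_exp (s t : R) : circ (exp s) t = Cexp (s, t).
Proof. reflexivity. Qed.

Lemma Cmod_circ (r t : R) : 0 <= r -> Cmod (circ r t) = r.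
Proof.
intros Hr. unfold Cmod, circ. simpl.
replace (r * cos t * (r * cos t * 1) + r * sin t * (r * sin t * 1))
  with (r * r * (Rsqr (sin t) + Rsqr (cos t))) by (unfold Rsqr; ring).
rewrite sin2_cos2, Rmult_1_r. apply sqrt_square, Hr.
Qed.

Lemma pcont_circ (r t : R) : pcont (circ r) t.
Proof.
intros eps He.
assert (H : pcont (fun s => r * Cexp (0, s))%C t).
{ apply pcont_mult; [apply pcont_const|]. apply (pcont_comp Cexp (fun s => (0, s))); [|apply pcont_vertical].
  apply ex_cderiv_ccont. exists (Cexp (0, t)). apply is_cderiv_Cexp. }
destruct (H eps He) as [d [Hd H1]]. exists d. split; auto. intros s Hs.
rewrite !circ_Cexp. auto.
Qed.

Definition ccont_circle (g : C -> C) (r : R) : Prop := forall w, Cmod w = r -> ccont g w.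

Definition cmean (g : C -> C) (r : R) : C :=
  (/ RtoC (2 * PI) * CInt (fun t => g (circ r t)) 0 (2 * PI))%C.

Lemma twoPI_pos : 0 < 2 * PI.
Proof. pose proof PI_RGT_0. lra. Qed.

Lemma twoPI_neq_0 : RtoC (2 * PI) <> 0.
Proof. intros H. apply RtoC_inj in H. pose proof twoPI_pos. lra. Qed.

Lemma pcont_on_circ (g : C -> C) (r : R) : 0 <= r -> ccont_circle g r ->
  pcont_on (fun t => g (circ r t)) 0 (2 * PI).
Proof.
intros Hr H t _. apply (pcont_comp g (circ r)); [|apply pcont_circ]. apply H, Cmod_circ, Hr.
Qed.

Section Cmean.
Context (r : R) (Hr : 0 <= r).

Lemma cmean_ext (f g : C -> C) : (forall w, Cmod w = r -> f w = g w) -> cmean f r = cmean g r.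
Proof.
intros H. unfold cmean. f_equal. apply CInt_ext; [pose proof twoPI_pos; lra|].
intros t _. apply H, Cmod_circ, Hr.
Qed.

Lemma cmean_plus (f g : C -> C) : ccont_circle f r -> ccont_circle g r ->
  cmean (fun w => f w + g w)%C r = (cmean f r + cmean g r)%C.
Proof.
intros Hf Hg. unfold cmean. rewrite CInt_plus; try (apply pcont_on_circ; auto); [ring|].
pose proof twoPI_pos; lra.
Qed.

Lemma cmean_minus (f g : C -> C) : ccont_circle f r -> ccont_circle g r ->
  cmean (fun w => f w - g w)%C r = (cmean f r - cmean g r)%C.
Proof.
intros Hf Hg. unfold cmean. rewrite CInt_minus; try (apply pcont_on_circ; auto); [ring|].
pose proof twoPI_pos; lra.
Qed.

Lemma cmean_scal (c : C) (f : C -> C) : ccont_circle f r ->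
  cmean (fun w => c * f w)%C r = (c * cmean f r)%C.
Proof.
intros Hf. unfold cmean. rewrite CInt_scal; try (apply pcont_on_circ; auto); [ring|].
pose proof twoPI_pos; lra.
Qed.

Lemma CInt_const (c : C) (a b : R) : a <= b -> CInt (fun _ => c) a b = (RtoC (b - a) * c)%C.
Proof.
intros H. rewrite (CInt_ext a b H _ (fun t => c + RtoC t * 0)%C) by (intros; ring).
rewrite CInt_affine by auto. ring.
Qed.

Lemma cmean_const (c : C) : cmean (fun _ => c) r = c.
Proof.
unfold cmean. rewrite CInt_const by (pose proof twoPI_pos; lra).
rewrite Rminus_0_r. field. apply twoPI_neq_0.
Qed.

End Cmean.

Lemma cmean_0 (g : C -> C) : cmean g 0 = g 0.
Proof.
rewrite <- (cmean_const 0 (g 0)). apply cmean_ext; [lra|].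
intros w Hw. apply Cmod_eq_0 in Hw. now rewrite Hw.
Qed.

(** In the logarithmic coordinate the annulus becomes a rectangle whose two
    horizontal sides carry the same values, so that Goursat's theorem compares
    its vertical sides, that is the two circles. *)
Lemma cmean_annulus (g : C -> C) (r1 r2 : R) : 0 < r1 -> r1 <= r2 ->
  (forall w, r1 <= Cmod w <= r2 -> ex_cderiv g w) -> cmean g r1 = cmean g r2.
Proof.
intros H1 H12 Hg.
assert (Hl : ln r1 <= ln r2) by (apply ln_le; auto).
pose proof twoPI_pos as HPI.
assert (HR := goursat (fun z => g (Cexp z)) (ln r1) (ln r2) 0 (2 * PI) Hl ltac:(lra)).
assert (HD : forall s t, ln r1 <= s <= ln r2 -> 0 <= t <= 2 * PI -> ex_cderiv (fun z => g (Cexp z)) (s, t)).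
{ intros s t Hs _. destruct (Hg (Cexp (s, t))) as [l Hl'].
  - rewrite <- circ_exp, Cmod_circ by (left; apply exp_pos).
    rewrite <- (exp_ln r1), <- (exp_ln r2) by lra.
    split; apply exp_mono; lra.
  - eexists. apply is_cderiv_comp; [exact Hl'|apply is_cderiv_Cexp]. }
specialize (HR HD). unfold rect_int in HR.
assert (E : CInt (fun s => g (Cexp (s, 0))) (ln r1) (ln r2) = CInt (fun s => g (Cexp (s, 2 * PI))) (ln r1) (ln r2)).
{ apply CInt_ext; auto. intros t _. unfold Cexp. simpl. now rewrite cos_2PI, sin_2PI, cos_0, sin_0. }
rewrite E in HR. unfold cmean.
assert (E2 : forall x, 0 < x -> CInt (fun t => g (Cexp (ln x, t))) 0 (2 * PI) = CInt (fun t => g (circ x t)) 0 (2 * PI)).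
{ intros x Hx. apply CInt_ext; [lra|]. intros t _. rewrite <- circ_exp, exp_ln; auto. }
rewrite !E2 in HR by lra. f_equal.
set (X := CInt (fun t => g (circ r1 t)) 0 (2 * PI)) in *.
set (Y := CInt (fun t => g (circ r2 t)) 0 (2 * PI)) in *.
clearbody X Y. set (Z := CInt _ _ _) in HR.
assert (Hi : (Ci * (Y - X) = 0)%C) by (rewrite <- HR; ring).
assert (Hd : (Y - X = 0)%C).
{ replace (Y - X)%C with (- (Ci * (Ci * (Y - X))))%C; [rewrite Hi; ring|].
  destruct X, Y. apply injective_projections; simpl; ring. }
replace Y with (X + (Y - X))%C by ring. rewrite Hd. ring.
Qed.

(** Stated for a component [P] of a complex number, in the real two-variable form
    to which the uniform continuity of compactness arguments applies. *)
Lemma continuity_2d_circ (g : C -> C) (P : C -> R) (r t : R) : 0 <= r -> ccont g (circ r t) ->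
  (forall c, Rabs (P c) <= Cmod c) -> (forall c d, P (c - d)%C = P c - P d) ->
  continuity_2d_pt (fun t r => P (g (circ r t))) t r.
Proof.
intros Hr0 Hg HP HP2 eps. rewrite ccont_Cmod in Hg.
destruct (Hg eps (cond_pos eps)) as [d [Hd H]].
assert (Hd2 : 0 < d / (2 * (r + 1))) by (apply Rdiv_lt_0_compat; lra).
assert (Hc : pcont (fun s => Cexp (0, s)) t).
{ apply (pcont_comp Cexp (fun s => (0, s))); [|apply pcont_vertical].
  apply ex_cderiv_ccont. exists (Cexp (0, t)). apply is_cderiv_Cexp. }
destruct (Hc (d / (2 * (r + 1))) Hd2) as [e [He2 H2]].
assert (Hm : 0 < Rmin e (d / 2)) by (apply Rmin_pos; lra).
exists (mkposreal _ Hm). simpl. intros u v Hu Hv.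
rewrite <- HP2. eapply Rle_lt_trans; [apply HP|]. apply H.
rewrite !circ_Cexp.
replace (v * Cexp (0, u) - r * Cexp (0, t))%C
  with (RtoC (v - r) * Cexp (0%R, u) + RtoC r * (Cexp (0%R, u) - Cexp (0%R, t)))%C
  by (rewrite RtoC_minus; ring).
eapply Rle_lt_trans; [apply Cmod_triangle|]. rewrite !Cmod_mult, !Cmod_R.
assert (U : Cmod (Cexp (0, u)) = 1).
{ rewrite <- circ_exp, exp_0, Cmod_circ; lra. }
rewrite U. rewrite (Rabs_pos_eq r) by auto.
specialize (H2 u (Rlt_le_trans _ _ _ Hu (Rmin_l _ _))).
assert (Hv2 := Rlt_le_trans _ _ _ Hv (Rmin_r _ _)).
assert (E : (r + 1) * (d / (2 * (r + 1))) = d / 2) by (field; lra).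
pose proof (Cmod_ge_0 (Cexp (0, u) - Cexp (0, t))). nra.
Qed.

(** On the compact circle of radius [r0], [g] is uniformly close to its values on
    nearby circles. *)
Lemma cmean_continuous (g : C -> C) (r0 : R) : 0 <= r0 < 1 ->
  (forall w, Cmod w < 1 -> ccont g w) ->
  forall eps, 0 < eps -> exists d, 0 < d /\
    forall r, 0 <= r < 1 -> Rabs (r - r0) < d -> Cmod (cmean g r - cmean g r0) < eps.
Proof.
intros Hr0 Hg eps He.
assert (Hp : 0 < eps / 8) by lra.
assert (K : forall P : C -> R, (forall c, Rabs (P c) <= Cmod c) -> (forall c d, P (c - d)%C = P c - P d) ->
  exists d : posreal, forall r t, 0 <= t <= 2 * PI -> Rabs (r - r0) < d ->
    Rabs (P (g (circ r t)) - P (g (circ r0 t))) < eps / 8).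
{ intros P HP1 HP2.
  destruct (uniform_continuity_2d_1d (fun t r => P (g (circ r t))) 0 (2 * PI) r0) with (mkposreal _ Hp) as [d Hd].
  - intros t _. apply continuity_2d_circ; try tauto. apply Hg. rewrite Cmod_circ; tauto.
  - exists d. intros r t Ht Hr. pose proof (cond_pos d). apply Rabs_def2 in Hr. simpl in Hd.
    apply Hd; try lra. rewrite Rminus_diag, Rabs_R0. lra. }
destruct (K Re re_le_Cmod ltac:(reflexivity)) as [d1 D1].
destruct (K Im im_le_Cmod ltac:(reflexivity)) as [d2 D2].
exists (Rmin d1 d2). split; [apply Rmin_pos; apply cond_pos|]. intros r Hr Hrr.
assert (C1 : pcont_on (fun t => g (circ r t)) 0 (2 * PI)).
{ apply pcont_on_circ; [tauto|]. intros w Hw. apply Hg. lra. }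
assert (C2 : pcont_on (fun t => g (circ r0 t)) 0 (2 * PI)).
{ apply pcont_on_circ; [tauto|]. intros w Hw. apply Hg. lra. }
unfold cmean.
pose proof twoPI_pos as HPI.
replace (/ RtoC (2 * PI) * CInt (fun t => g (circ r t)) 0 (2 * PI) - / RtoC (2 * PI) * CInt (fun t => g (circ r0 t)) 0 (2 * PI))%C
  with (/ RtoC (2 * PI) * (CInt (fun t => g (circ r t)) 0 (2 * PI) - CInt (fun t => g (circ r0 t)) 0 (2 * PI)))%C by ring.
rewrite <- CInt_minus by (auto; lra).
rewrite Cmod_mult, Cmod_inv, Cmod_R, Rabs_pos_eq by (try apply twoPI_neq_0; lra).
assert (B : Cmod (CInt (fun t => g (circ r t) - g (circ r0 t))%C 0 (2 * PI)) <= 2 * (eps / 4) * (2 * PI - 0)).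
{ apply CInt_le; [lra| |].
  - intros t Ht. apply (pcont_plus (fun t => g (circ r t)) (fun t => - g (circ r0 t))%C); [apply C1, Ht|].
    intros e He'. destruct (C2 t Ht e He') as [d [Hd H]]. exists d. split; auto. intros s Hs.
    replace (- g (circ r0 s) - - g (circ r0 t))%C with (- (g (circ r0 s) - g (circ r0 t)))%C by ring.
    rewrite Cmod_opp. auto.
  - intros t Ht. eapply Rle_trans; [apply Cmod_le_Re_Im|].
    specialize (D1 r t Ht (Rlt_le_trans _ _ _ Hrr (Rmin_l _ _))).
    specialize (D2 r t Ht (Rlt_le_trans _ _ _ Hrr (Rmin_r _ _))). 
    change (Re (g (circ r t) - g (circ r0 t))%C) with (Re (g (circ r t)) - Re (g (circ r0 t))).
    change (Im (g (circ r t) - g (circ r0 t))%C) with (Im (g (circ r t)) - Im (g (circ r0 t))).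
    lra. }
apply Rle_lt_trans with (eps / 2); [|lra].
apply Rmult_le_reg_l with (2 * PI); [lra|]. rewrite <- Rmult_assoc, Rinv_r, Rmult_1_l by lra.
lra.
Qed.

Lemma cmean_limit (g : C -> C) (r0 : R) (K : C) : 0 <= r0 < 1 ->
  (forall w, Cmod w < 1 -> ccont g w) ->
  (forall d, 0 < d -> exists r, 0 <= r < 1 /\ Rabs (r - r0) < d /\ cmean g r = K) ->
  cmean g r0 = K.
Proof.
intros Hr0 Hg H.
destruct (Req_dec (Cmod (cmean g r0 - K)) 0) as [E|E].
- apply Cmod_eq_0 in E. replace (cmean g r0) with (cmean g r0 - K + K)%C by ring. rewrite E. ring.
- exfalso. pose proof (Cmod_ge_0 (cmean g r0 - K)).
  destruct (cmean_continuous g r0 Hr0 Hg (Cmod (cmean g r0 - K)) ltac:(lra)) as [d [Hd H1]].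
  destruct (H d Hd) as [r [Hr [Hrr <-]]]. specialize (H1 r Hr Hrr).
  replace (cmean g r0 - cmean g r)%C with (- (cmean g r - cmean g r0))%C in H1 by ring.
  rewrite Cmod_opp in H1. lra.
Qed.

(** The mean value property. Circles on either side of the exceptional point are
    compared by continuity of the mean in the radius, which lets a removable
    singularity through. *)
Theorem cmean_value (g : C -> C) (z0 : C) (r : R) : 0 <= r < 1 ->
  (forall w, Cmod w < 1 -> ccont g w) ->
  (forall w, Cmod w < 1 -> w <> z0 -> ex_cderiv g w) ->
  cmean g r = g 0.
Proof.
intros Hr Hc Hd. rewrite <- cmean_0. set (rho := Cmod z0).
assert (Hrho : 0 <= rho) by apply Cmod_ge_0.
assert (A : forall s, 0 <= s < 1 -> s < rho -> cmean g s = cmean g 0).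
{ intros s Hs Hsr. destruct (Req_dec s 0) as [->|Hs0]; [reflexivity|].
  symmetry. apply cmean_limit; [lra|auto|]. intros d Hdp.
  exists (Rmin s (d / 2)).
  assert (0 < Rmin s (d / 2)) by (apply Rmin_pos; lra).
  pose proof (Rmin_l s (d / 2)). pose proof (Rmin_r s (d / 2)).
  repeat split; try lra.
  - rewrite Rminus_0_r, Rabs_pos_eq; lra.
  - apply cmean_annulus; auto. intros w Hw. apply Hd; [lra|]. intros ->. fold rho in Hw. lra. }
assert (B : forall s, 0 <= s < 1 -> s <= rho -> cmean g s = cmean g 0).
{ intros s Hs Hsr. destruct (Req_dec s 0) as [->|Hs0]; [reflexivity|].
  apply cmean_limit; [lra|auto|]. intros d Hdp.
  exists (s - Rmin s (d / 2)).
  assert (0 < Rmin s (d / 2)) by (apply Rmin_pos; lra).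
  pose proof (Rmin_l s (d / 2)). pose proof (Rmin_r s (d / 2)).
  repeat split; try lra.
  - rewrite Rabs_left; lra.
  - apply A; lra. }
destruct (Rle_dec r rho) as [Hle|Hnle]; [apply B; auto|].
rewrite <- (B rho) by lra. symmetry. apply cmean_limit; [lra|auto|]. intros d Hdp.
exists (Rmin r (rho + d / 2)).
assert (rho < Rmin r (rho + d / 2)) by (apply Rmin_glb_lt; lra).
pose proof (Rmin_l r (rho + d / 2)). pose proof (Rmin_r r (rho + d / 2)).
repeat split; try lra.
- rewrite Rabs_pos_eq; lra.
- apply cmean_annulus; try lra. intros w Hw. apply Hd; [lra|]. intros ->. fold rho in Hw. lra.
Qed.

(** * Cauchy's power series expansion *)

Definition is_cpseries (a : nat -> C) (z l : C) : Prop :=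
  @is_pseries C_AbsRing C_NormedModule a z l.

(** The sum of the first [n] terms, whereas [sum_n] has [n + 1] of them. *)
Fixpoint psum (a : nat -> C) (z : C) (n : nat) : C :=
  match n with O => 0 | S n => (psum a z n + a n * z ^ n)%C end.

Lemma pow_n_Cpow (z : C) (n : nat) : @pow_n C_Ring z n = (z ^ n)%C.
Proof. induction n as [|n IH]; [reflexivity|]. simpl. rewrite IH. reflexivity. Qed.

Lemma sum_n_psum (a : nat -> C) (z : C) (n : nat) :
  @sum_n C_AbelianMonoid (fun k => @scal C_Ring C_ModuleSpace (@pow_n C_Ring z k) (a k)) n = psum a z (S n).
Proof.
induction n as [|n IH].
- rewrite sum_O. simpl. unfold scal; simpl. unfold mult, one; simpl. ring.
- rewrite sum_Sn, IH. change (psum a z (S (S n))) with (psum a z (S n) + a (S n) * z ^ (S n))%C.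
  unfold plus; simpl. f_equal. rewrite pow_n_Cpow. unfold scal; simpl. unfold mult; simpl. ring.
Qed.

Lemma is_cpseries_Cmod (a : nat -> C) (z l : C) :
  is_cpseries a z l <-> forall eps, 0 < eps -> exists N, forall n, (N <= n)%nat ->
    Cmod (psum a z n - l) < eps.
Proof.
unfold is_cpseries, is_pseries, is_series. rewrite (filterlim_Cmod _ _ l). split.
- intros H eps He. destruct (H eps He) as [N HN]. exists (S N). intros [|n] Hn; [lia|].
  rewrite <- sum_n_psum. apply HN. lia.
- intros H eps He. destruct (H eps He) as [N HN]. exists N. intros n Hn.
  rewrite sum_n_psum. apply HN. lia.
Qed.

Lemma ccont_circle_bounded (g : C -> C) (r : R) : 0 <= r -> ccont_circle g r ->
  exists M, 0 <= M /\ forall t, 0 <= t <= 2 * PI -> Cmod (g (circ r t)) <= M.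
Proof.
intros Hr Hg. assert (Hp := pcont_on_circ g r Hr Hg).
pose proof twoPI_pos.
destruct (continuity_ab_maj (fun t => Cmod (g (circ r t))) 0 (2 * PI)) as [x [Hx _]].
- lra.
- intros t Ht. intros eps He. destruct (Hp t Ht eps He) as [d [Hd H1]].
  exists d. split; auto. intros s [_ Hs]. specialize (H1 s Hs). unfold dist; simpl. unfold Rdist.
  eapply Rle_lt_trans; [|exact H1].
  assert (T : forall u v, Cmod u <= Cmod v + Cmod (u - v)).
  { intros u v. replace u with (v + (u - v))%C at 1 by ring. apply Cmod_triangle. }
  pose proof (T (g (circ r s)) (g (circ r t))). pose proof (T (g (circ r t)) (g (circ r s))).
  replace (g (circ r t) - g (circ r s))%C with (- (g (circ r s) - g (circ r t)))%C in * by ring.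
  rewrite Cmod_opp in *. apply Rabs_le. lra.
- exists (Cmod (g (circ r x))). split; [apply Cmod_ge_0|exact Hx].
Qed.

Lemma Ceq_dec (z w : C) : {z = w} + {z <> w}.
Proof.
destruct z as [a b], w as [c d].
destruct (Req_EM_T a c) as [->|H]; [|right; congruence].
destruct (Req_EM_T b d) as [->|H]; [left; reflexivity|right; congruence].
Defined.

Lemma Cmod_neq_0 (w : C) : 0 < Cmod w -> w <> 0.
Proof. intros H ->. rewrite Cmod_0 in H. lra. Qed.

(** The mean scales like [r^-k] with the radius, yet does not depend on it. *)
Lemma cmean_inv_pow (k : nat) (r : R) : 0 < r -> (1 <= k)%nat ->
  cmean (fun w => / w ^ k)%C r = 0.
Proof.
intros Hr Hk.
assert (E : cmean (fun w => / w ^ k)%C r = cmean (fun w => / w ^ k)%C (2 * r)).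
{ apply cmean_annulus; try lra. intros w Hw.
  eexists. apply (is_cderiv_comp Cinv (fun w => w ^ k)%C); [|apply is_cderiv_pow].
  apply is_cderiv_inv, Cpow_nz, Cmod_neq_0. lra. }
assert (E2 : cmean (fun w => / w ^ k)%C (2 * r) = (/ RtoC 2 ^ k * cmean (fun w => / w ^ k)%C r)%C).
{ rewrite <- cmean_scal; try lra.
  - unfold cmean. f_equal. apply CInt_ext; [pose proof twoPI_pos; lra|]. intros t _.
    replace (circ (2 * r) t) with (RtoC 2 * circ r t)%C.
    + rewrite Cpow_mult_l. field. split; apply Cpow_nz; [|intros H; apply RtoC_inj in H; lra].
      apply Cmod_neq_0. rewrite Cmod_circ; lra.
    + apply injective_projections; simpl; ring.
  - intros w Hw. apply ccont_inv; [apply ccont_pow|]. apply Cpow_nz, Cmod_neq_0. lra. }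
rewrite E2 in E. set (X := cmean _ _) in *. clearbody X.
assert (E3 : ((1 - / RtoC 2 ^ k) * X = 0)%C) by (replace ((1 - / RtoC 2 ^ k) * X)%C with (X - / RtoC 2 ^ k * X)%C by ring; rewrite <- E; ring).
destruct (Req_dec (Cmod X) 0) as [H|H]; [apply Cmod_eq_0, H|exfalso].
assert (H1 : (1 - / RtoC 2 ^ k)%C <> 0).
{ rewrite <- RtoC_pow, <- RtoC_inv, <- RtoC_minus by (apply pow_nonzero; lra). intros C0. apply RtoC_inj in C0.
  assert (1 < 2 ^ k) by (apply Rlt_pow_R1; [lra|lia]).
  assert (/ 2 ^ k < / 1) by (apply Rinv_lt_contravar; lra). lra. }
apply (Cmult_neq_0 _ _ H1) in E3; [exact E3|]. intros ->. rewrite Cmod_0 in H. lra.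
Qed.

(** Cauchy's formula for a Taylor coefficient; by [cauchy_coef_radius] the radius
    1/2 is an arbitrary choice. *)
Definition cauchy_coef (f : C -> C) (n : nat) : C := cmean (fun w => f w / w ^ n)%C (1 / 2).

Definition disc_holomorphic (f : C -> C) : Prop := forall z, Cmod z < 1 -> ex_cderiv f z.

Lemma cauchy_coef_radius (f : C -> C) (n : nat) (r : R) : 0 < r < 1 -> disc_holomorphic f ->
  cmean (fun w => f w / w ^ n)%C r = cauchy_coef f n.
Proof.
intros Hr Hf.
assert (D : forall w, 0 < Cmod w < 1 -> ex_cderiv (fun w => f w / w ^ n)%C w).
{ intros w Hw. destruct (Hf w ltac:(lra)) as [l Hl]. eexists.
  apply is_cderiv_div; [|exact Hl|apply is_cderiv_pow]. apply Cpow_nz, Cmod_neq_0. lra. }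
unfold cauchy_coef. destruct (Rle_dec r (1 / 2)).
- apply cmean_annulus; try lra. intros w Hw. apply D. lra.
- symmetry. apply cmean_annulus; try lra. intros w Hw. apply D. lra.
Qed.

(** The difference quotient of [f] at [z] extends continuously to [z], so the
    mean value property applies to [w (f w - f z) / (w - z)]; expanding
    [w / (w - z)] in powers of [z / w] turns it into the expansion of [f]. *)
Theorem cauchy_expansion (f : C -> C) : disc_holomorphic f ->
  forall z, Cmod z < 1 -> is_cpseries (cauchy_coef f) z (f z).
Proof.
intros Hf z Hz.
destruct (Hf z Hz) as [l Hl].
set (q := fun w => if Ceq_dec w z then (z * l)%C else (w * (f w - f z) / (w - z))%C).
assert (Hq : forall w, w <> z -> q w = (w * (f w - f z) / (w - z))%C).
{ intros w Hw. unfold q. destruct (Ceq_dec w z); tauto. }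
assert (Hqd : forall w, Cmod w < 1 -> w <> z -> ex_cderiv q w).
{ intros w Hw Hwz. destruct (Hf w Hw) as [g Hg]. eexists.
  assert (Hp : 0 < Cmod (w - z)).
  { apply Cmod_gt_0. intros E. apply Hwz. replace w with (w - z + z)%C by ring. rewrite E. ring. }
  apply (is_cderiv_ext_near (fun w => w * (f w - f z) / (w - z))%C _ w _ (Cmod (w - z)) Hp).
  - intros v Hv. symmetry. apply Hq. intros ->. replace (w - z)%C with (- (z - w))%C in Hv by ring.
    rewrite Cmod_opp in Hv. lra.
  - apply is_cderiv_div.
    + apply Cmod_gt_0, Hp.
    + apply is_cderiv_mult; [apply is_cderiv_id|]. apply is_cderiv_minus; [exact Hg|apply is_cderiv_const].
    + apply is_cderiv_minus; [apply is_cderiv_id|apply is_cderiv_const]. }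
assert (Hqc : forall w, Cmod w < 1 -> ccont q w).
{ intros w Hw. destruct (Ceq_dec w z) as [->|Hwz]; [|apply ex_cderiv_ccont, Hqd; auto].
  set (dq := fun v => if Ceq_dec v z then l else ((f v - f z) / (v - z))%C).
  apply (ccont_ext_near (fun v => v * dq v)%C q z 1); [lra| |].
  - intros v _. unfold q, dq. destruct (Ceq_dec v z) as [->|]; [reflexivity|]. unfold Cdiv. ring.
  - apply ccont_mult; [apply ccont_id|]. apply ccont_Cmod. intros eps He.
    rewrite is_cderiv_Cmod in Hl. destruct (Hl (eps / 2) ltac:(lra)) as [d [Hd H1]].
    exists d. split; auto. intros v Hv. unfold dq. destruct (Ceq_dec z z) as [_|]; [|tauto].
    destruct (Ceq_dec v z) as [->|Hvz].
    + replace (l - l)%C with (RtoC 0) by ring. rewrite Cmod_0. exact He.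
    + assert (Hp : (v - z)%C <> 0).
      { intros E. apply Hvz. replace v with (v - z + z)%C by ring. rewrite E. ring. }
      replace ((f v - f z) / (v - z) - l)%C with ((f v - f z - (v - z) * l) / (v - z))%C by (field; auto).
      rewrite Cmod_div by auto. apply Cmod_gt_0 in Hp.
      apply Rle_lt_trans with (eps / 2); [|lra].
      apply Rmult_le_reg_r with (Cmod (v - z)); [auto|].
      unfold Rdiv at 1. rewrite Rmult_assoc, Rinv_l, Rmult_1_r by lra. apply H1, Hv. }
set (r := (1 + Cmod z) / 2). pose proof (Cmod_ge_0 z) as Hz0.
assert (Hr : 0 < r < 1) by (unfold r; lra). assert (Hzr : Cmod z < r) by (unfold r; lra).
assert (Hw0 : forall w, Cmod w = r -> w <> 0) by (intros w Hw; apply Cmod_neq_0; lra).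
assert (Hwz : forall w, Cmod w = r -> w <> z) by (intros w Hw ->; lra).
assert (Hwz' : forall w, Cmod w = r -> (w - z)%C <> 0).
{ intros w Hw E. apply (Hwz w Hw). replace w with (w - z + z)%C by ring. rewrite E. ring. }
assert (Cp : forall k, ccont_circle (fun w => / w ^ k)%C r).
{ intros k w Hw. apply ccont_inv; [apply ccont_pow|]. apply Cpow_nz; auto. }
assert (Cf : ccont_circle f r) by (intros w Hw; apply ex_cderiv_ccont, Hf; lra).
assert (Cq : ccont_circle q r) by (intros w Hw; apply Hqc; lra).
set (E := fun k => cmean (fun w => q w / w ^ k)%C r).
assert (Hcq : forall k, ccont_circle (fun w => q w / w ^ k)%C r).
{ intros k w Hw. apply (ccont_mult q (fun w => / w ^ k)%C); [apply Cq, Hw|apply Cp, Hw]. }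
assert (Hcf : forall k, ccont_circle (fun w => f w / w ^ k)%C r).
{ intros k w Hw. apply (ccont_mult f (fun w => / w ^ k)%C); [apply Cf, Hw|apply Cp, Hw]. }
(* [w / (w - z) = 1 + (z / w) (w / (w - z))] peels one power of [z / w] off. *)
assert (Rec : forall k, E k = (cauchy_coef f k - f z * cmean (fun w => / w ^ k)%C r + z * E (S k))%C).
{ intros k. unfold E. rewrite <- (cauchy_coef_radius f k r Hr Hf).
  rewrite <- !cmean_scal by (try lra; auto).
  rewrite <- cmean_minus; try lra; auto.
  2:{ intros w Hw. apply (ccont_mult (fun _ => f z) (fun w => / w ^ k)%C); [apply ccont_const|apply Cp, Hw]. }
  rewrite <- cmean_plus; try lra.
  - apply cmean_ext; [lra|]. intros w Hw. rewrite Hq by auto. simpl. field.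
    repeat split; auto. apply Cpow_nz; auto.
  - intros w Hw. apply (ccont_plus (fun w => f w / w ^ k)%C (fun w => - (f z * / w ^ k))%C); [apply Hcf, Hw|].
    apply (ccont_ext_near (fun w => (- f z) * / w ^ k)%C _ w 1); [lra|intros; ring|].
    apply (ccont_mult (fun _ => - f z)%C (fun w => / w ^ k)%C); [apply ccont_const|apply Cp, Hw].
  - intros w Hw. apply (ccont_mult (fun _ => z) (fun w => q w / w ^ (S k))%C); [apply ccont_const|].
    apply (Hcq (S k)), Hw. }
assert (E0 : E O = 0).
{ unfold E. rewrite (cmean_ext r ltac:(lra) _ q).
  - rewrite (cmean_value q z r ltac:(lra) Hqc Hqd). unfold q. destruct (Ceq_dec 0 z) as [<-|]; [ring|].
    unfold Cdiv. ring.
  - intros w _. simpl. field. }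
assert (Id : forall n, (psum (cauchy_coef f) z (S n) - f z = - z ^ (S n) * E (S n))%C).
{ induction n as [|n IH].
  - simpl. assert (R0 := Rec O). rewrite E0 in R0.
    rewrite (cmean_ext r ltac:(lra) _ (fun _ => 1)), cmean_const in R0; [|intros w _; simpl; field].
    replace (0 + cauchy_coef f 0 * 1 - f z)%C with ((cauchy_coef f 0 - f z * 1 + z * E 1%nat) - z * E 1%nat)%C by ring.
    rewrite <- R0. ring.
  - change (psum (cauchy_coef f) z (S (S n))) with (psum (cauchy_coef f) z (S n) + cauchy_coef f (S n) * z ^ (S n))%C.
    replace (psum (cauchy_coef f) z (S n) + cauchy_coef f (S n) * z ^ S n - f z)%C
      with ((psum (cauchy_coef f) z (S n) - f z) + cauchy_coef f (S n) * z ^ S n)%C by ring.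
    rewrite IH, (Rec (S n)), cmean_inv_pow by (lia || lra). simpl. ring. }
destruct (ccont_circle_bounded q r ltac:(lra) Cq) as [M [HM HMb]].
(* [z^n E n] tends to 0, because [|z| < r]. *)
assert (HE : forall n, Cmod (E n) <= 2 * (M / r ^ n)).
{ intros n. unfold E, cmean. rewrite Cmod_mult, Cmod_inv by apply twoPI_neq_0.
  rewrite Cmod_R, Rabs_pos_eq by (pose proof twoPI_pos; lra). pose proof twoPI_pos.
  assert (Cmod (CInt (fun t => q (circ r t) / circ r t ^ n)%C 0 (2 * PI)) <= 2 * (M / r ^ n) * (2 * PI - 0)).
  { apply CInt_le; [lra| |].
    - apply (pcont_on_circ (fun w => q w / w ^ n)%C); [lra|auto].
    - intros t Ht. rewrite Cmod_div, Cmod_pow, Cmod_circ by (try lra; apply Cpow_nz, Hw0, Cmod_circ; lra).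
      apply Rmult_le_compat_r; [left; apply Rinv_0_lt_compat, pow_lt; lra|auto]. }
  apply Rmult_le_reg_l with (2 * PI); [lra|]. rewrite <- Rmult_assoc, Rinv_r, Rmult_1_l by lra. lra. }
apply is_cpseries_Cmod. intros eps He.
set (x := Cmod z / r).
assert (Hx : 0 <= x < 1).
{ unfold x. split; [apply Rdiv_le_0_compat; lra|]. apply Rmult_lt_reg_r with r; [lra|].
  unfold Rdiv. rewrite Rmult_assoc, Rinv_l; lra. }
destruct (pow_lt_1_zero x ltac:(rewrite Rabs_pos_eq; lra) (eps / (2 * (M + 1))) ltac:(apply Rdiv_lt_0_compat; lra)) as [N HN].
exists (S N). intros [|n] Hn; [lia|]. rewrite Id, Cmod_mult, Cmod_opp, Cmod_pow.
specialize (HN (S n) ltac:(lia)). rewrite Rabs_pos_eq in HN by (apply pow_le; lra).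
specialize (HE (S n)).
assert (Hpr : 0 < r ^ S n) by (apply pow_lt; lra).
assert (Hpz : 0 <= Cmod z ^ S n) by (apply pow_le; lra).
assert (Hxe : x ^ S n = Cmod z ^ S n / r ^ S n) by (unfold x, Rdiv; rewrite Rpow_mult_distr, pow_inv; reflexivity).
eapply Rle_lt_trans; [apply Rmult_le_compat_l; [exact Hpz|exact HE]|].
replace (Cmod z ^ S n * (2 * (M / r ^ S n))) with (2 * M * x ^ S n) by (rewrite Hxe; field; lra).
assert (0 <= x ^ S n) by (apply pow_le; lra).
apply Rmult_lt_compat_l with (r := 2 * (M + 1)) in HN; [|lra].
replace (2 * (M + 1) * (eps / (2 * (M + 1)))) with eps in HN by (field; lra). nra.
Qed.

(** * Power series on the unit disc *)

(** By the root test this says that the radius of convergence is at least 1. *)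
Definition disc_bounded (a : nat -> C) : Prop :=
  forall rho, 0 < rho < 1 -> exists M, forall n, Cmod (a n) * rho ^ n <= M.

(** Total, with the value of the sum wherever the series converges. *)
Definition csum (a : nat -> C) (z : C) : C :=
  (real (Lim_seq (fun n => Re (psum a z n))), real (Lim_seq (fun n => Im (psum a z n)))).

Definition shift (a : nat -> C) (n : nat) : C := a (S n).
Definition dcoef (a : nat -> C) (n : nat) : C := (INR (S n) * a (S n))%C.

Lemma psum_ext (a b : nat -> C) (z : C) (n : nat) :
  (forall k, a k = b k) -> psum a z n = psum b z n.
Proof. intros H. induction n as [|n IH]; simpl; [reflexivity|now rewrite IH, H]. Qed.

Lemma is_cpseries_csum (a : nat -> C) (z l : C) : is_cpseries a z l -> csum a z = l.
Proof.
rewrite is_cpseries_Cmod. intros H.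
assert (K : forall P : C -> R, (forall c, Rabs (P c) <= Cmod c) -> (forall c d, P (c - d)%C = P c - P d) ->
  real (Lim_seq (fun n => P (psum a z n))) = P l).
{ intros P H1 H2. replace (P l) with (real (Finite (P l))) by reflexivity. f_equal.
  apply is_lim_seq_unique, is_lim_seq_spec. intros eps.
  destruct (H eps (cond_pos eps)) as [N HN]. exists N. intros n Hn.
  rewrite <- H2. eapply Rle_lt_trans; [apply H1|apply HN, Hn]. }
unfold csum. rewrite (K Re re_le_Cmod), (K Im im_le_Cmod) by reflexivity.
destruct l; reflexivity.
Qed.

Lemma is_cpseries_bounded (a : nat -> C) (z l : C) : is_cpseries a z l ->
  exists M, forall n, Cmod (a n) * Cmod z ^ n <= M.
Proof.
rewrite is_cpseries_Cmod. intros H. destruct (H 1 ltac:(lra)) as [N HN].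
assert (F : exists M, 0 <= M /\ forall n, (n < N)%nat -> Cmod (a n) * Cmod z ^ n <= M).
{ clear HN. induction N as [|N [M [HM0 HM]]].
  - exists 0. split; [lra|]. intros; lia.
  - exists (Rmax M (Cmod (a N) * Cmod z ^ N)). split; [eapply Rle_trans; [exact HM0|apply Rmax_l]|].
    intros n Hn. destruct (Nat.eq_dec n N) as [->|]; [apply Rmax_r|].
    eapply Rle_trans; [apply HM; lia|apply Rmax_l]. }
destruct F as [M [HM0 HM]]. exists (M + 2). intros n.
destruct (Nat.lt_ge_cases n N) as [Hn|Hn]; [specialize (HM n Hn); lra|].
rewrite <- Cmod_pow, <- Cmod_mult.
assert (H1 := HN n Hn). assert (H2 := HN (S n) ltac:(lia)). simpl in H2.
replace (a n * z ^ n)%C with ((psum a z n + a n * z ^ n - l) + - (psum a z n - l))%C by ring.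
eapply Rle_trans; [apply Cmod_triangle|]. rewrite Cmod_opp. lra.
Qed.

Lemma disc_bounded_of_cpseries (a : nat -> C) :
  (forall z, Cmod z < 1 -> exists l, is_cpseries a z l) -> disc_bounded a.
Proof.
intros H rho Hr. destruct (H (RtoC rho)) as [l Hl]; [rewrite Cmod_R, Rabs_pos_eq; lra|].
apply is_cpseries_bounded in Hl. rewrite Cmod_R, Rabs_pos_eq in Hl by lra. exact Hl.
Qed.

(** [n x^n] is bounded for [x < 1] by Bernoulli's inequality applied to [1 / x]. *)
Lemma disc_bounded_mul_INR (a : nat -> C) : disc_bounded a ->
  disc_bounded (fun n => INR n * a n)%C.
Proof.
intros H rho Hr. destruct (H ((1 + rho) / 2) ltac:(lra)) as [M HM].
set (s := (1 + rho) / 2) in *. set (d := s / rho - 1).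
assert (Hs : rho < s) by (unfold s; lra).
assert (Hd : 0 < d). { unfold d. apply Rlt_0_minus. apply Rmult_lt_reg_r with rho; [lra|]. unfold Rdiv. rewrite Rmult_assoc, Rinv_l; lra. }
exists (M / d). intros n. rewrite Cmod_mult, Cmod_R, Rabs_pos_eq by apply pos_INR.
assert (B := poly n d Hd). replace (1 + d) with (s / rho) in B by (unfold d; ring).
specialize (HM n).
assert (Hp : 0 < rho ^ n) by (apply pow_lt; lra).
unfold Rdiv in B. rewrite Rpow_mult_distr, pow_inv in B.
assert (B2 : INR n * d * rho ^ n <= s ^ n).
{ apply Rmult_le_reg_r with (/ rho ^ n); [apply Rinv_0_lt_compat, Hp|].
  rewrite Rmult_assoc, Rinv_r, Rmult_1_r by lra. lra. }
apply Rmult_le_reg_r with d; [exact Hd|]. unfold Rdiv. rewrite (Rmult_assoc M), Rinv_l, Rmult_1_r by lra.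
pose proof (Cmod_ge_0 (a n)). 
replace (INR n * Cmod (a n) * rho ^ n * d) with (Cmod (a n) * (INR n * d * rho ^ n)) by ring.
eapply Rle_trans; [apply Rmult_le_compat_l; [auto|exact B2]|exact HM].
Qed.

Lemma disc_bounded_shift (a : nat -> C) : disc_bounded a -> disc_bounded (shift a).
Proof.
intros H rho Hr. destruct (H rho Hr) as [M HM]. exists (M / rho). intros n. unfold shift.
specialize (HM (S n)). simpl in HM. apply Rmult_le_reg_r with rho; [lra|].
unfold Rdiv. rewrite (Rmult_assoc M), Rinv_l, Rmult_1_r by lra. lra.
Qed.

Lemma disc_bounded_dcoef (a : nat -> C) : disc_bounded a -> disc_bounded (dcoef a).
Proof. intros H. exact (disc_bounded_shift _ (disc_bounded_mul_INR a H)). Qed.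

Lemma disc_bounded_le (a b : nat -> C) : disc_bounded a ->
  (forall n, Cmod (b n) <= Cmod (a n)) -> disc_bounded b.
Proof.
intros H Hb rho Hr. destruct (H rho Hr) as [M HM]. exists M. intros n.
eapply Rle_trans; [|apply (HM n)]. apply Rmult_le_compat_r; [apply pow_le; lra|apply Hb].
Qed.

Fixpoint rsum (u : nat -> R) (n : nat) : R :=
  match n with O => 0 | S n => rsum u n + u n end.

Lemma disc_bounded_geometric (a : nat -> C) (rho : R) : disc_bounded a -> 0 <= rho < 1 ->
  exists M x, 0 <= M /\ 0 <= x < 1 /\ forall n, Cmod (a n) * rho ^ n <= M * x ^ n.
Proof.
intros H Hr. set (s := (1 + rho) / 2). assert (Hs : rho < s < 1) by (unfold s; lra).
destruct (H s ltac:(lra)) as [M HM]. exists M, (rho / s). 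
assert (Hx : 0 <= rho / s < 1).
{ split; [apply Rdiv_le_0_compat; lra|]. apply Rmult_lt_reg_r with s; [lra|].
  unfold Rdiv. rewrite Rmult_assoc, Rinv_l; lra. }
split; [|split; [exact Hx|]].
- specialize (HM O). simpl in HM. pose proof (Cmod_ge_0 (a O)). lra.
- intros n. specialize (HM n).
  replace (rho ^ n) with (s ^ n * (rho / s) ^ n) by (rewrite <- Rpow_mult_distr; f_equal; field; lra).
  rewrite <- Rmult_assoc. apply Rmult_le_compat_r; [apply pow_le; lra|exact HM].
Qed.

Lemma disc_bounded_rsum (a : nat -> C) (rho : R) : disc_bounded a -> 0 <= rho < 1 ->
  exists K, 0 <= K /\ forall n, rsum (fun k => Cmod (a k) * rho ^ k) n <= K.
Proof.
intros H Hr. destruct (disc_bounded_geometric a rho H Hr) as (M & x & HM & Hx & B).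
exists (M / (1 - x)). split; [apply Rdiv_le_0_compat; lra|]. intros n.
assert (I : rsum (fun k => Cmod (a k) * rho ^ k) n * (1 - x) <= M * (1 - x ^ n)).
{ induction n as [|n IH]; simpl; [lra|]. specialize (B n).
  assert (0 <= x ^ n) by (apply pow_le; lra). nra. }
assert (0 <= x ^ n) by (apply pow_le; lra).
apply Rmult_le_reg_r with (1 - x); [lra|]. unfold Rdiv. rewrite (Rmult_assoc M), Rinv_l by lra. nra.
Qed.

Lemma csum_correct (a : nat -> C) (z : C) : disc_bounded a -> Cmod z < 1 -> is_cpseries a z (csum a z).
Proof.
intros H Hz. pose proof (Cmod_ge_0 z).
destruct (disc_bounded_geometric a (Cmod z) H ltac:(lra)) as (M & x & HM & Hx & B).
assert (E : @ex_series C_AbsRing C_CompleteNormedModule (fun k => @scal C_Ring C_ModuleSpace (@pow_n C_Ring z k) (a k))).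
{ apply (ex_series_le (K := C_AbsRing) (V := C_CompleteNormedModule)) with (b := fun n => M * x ^ n).
  - intros n. rewrite pow_n_Cpow.
    change (Cmod (z ^ n * a n) <= M * x ^ n). rewrite Cmod_mult, Cmod_pow, Rmult_comm. apply B.
  - apply (ex_series_scal (K := R_AbsRing) (V := R_NormedModule) M). apply ex_series_geom. rewrite Rabs_pos_eq; lra. }
destruct E as [l Hl]. assert (Hl2 : is_cpseries a z l) by exact Hl.
now rewrite (is_cpseries_csum a z l Hl2).
Qed.

Lemma psum_shift (a : nat -> C) (z : C) (n : nat) :
  psum a z (S n) = (a O + z * psum (shift a) z n)%C.
Proof.
induction n as [|n IH]; [simpl; ring|].
change (psum a z (S (S n))) with (psum a z (S n) + a (S n) * z ^ (S n))%C.
rewrite IH. simpl. unfold shift at 3. ring.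
Qed.

Lemma csum_shift (a : nat -> C) (z : C) : disc_bounded a -> Cmod z < 1 ->
  csum a z = (a O + z * csum (shift a) z)%C.
Proof.
intros H Hz. apply is_cpseries_csum. apply is_cpseries_Cmod. intros eps He.
assert (K := csum_correct _ z (disc_bounded_shift a H) Hz). rewrite is_cpseries_Cmod in K.
destruct (K eps He) as [N HN]. exists (S N). intros [|n] Hn; [lia|].
rewrite psum_shift. specialize (HN n ltac:(lia)).
replace (a O + z * psum (shift a) z n - (a O + z * csum (shift a) z))%C
  with (z * (psum (shift a) z n - csum (shift a) z))%C by ring.
rewrite Cmod_mult. pose proof (Cmod_ge_0 (psum (shift a) z n - csum (shift a) z)). 
pose proof (Cmod_ge_0 z). nra.
Qed.

Lemma csum_0 (a : nat -> C) : disc_bounded a -> csum a 0 = a O.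
Proof. intros H. rewrite csum_shift; [ring|auto|rewrite Cmod_0; lra]. Qed.

Lemma csum_ext (a b : nat -> C) (z : C) : (forall n, a n = b n) -> csum a z = csum b z.
Proof.
intros H. unfold csum. f_equal; f_equal; apply Lim_seq_ext; intros n; now rewrite (psum_ext a b).
Qed.

(** Multiplying by [rho^2] avoids the exponent [n - 2] of the natural bound. *)
Lemma pow_taylor2 (z w : C) (rho : R) (n : nat) : Cmod z <= rho -> Cmod w <= rho ->
  rho * rho * Cmod (w ^ n - z ^ n - (w - z) * (INR n * z ^ (pred n)))
  <= INR n * INR n * rho ^ n * (Cmod (w - z) * Cmod (w - z)).
Proof.
intros Hz Hw. pose proof (Cmod_ge_0 z). pose proof (Cmod_ge_0 w).
induction n as [|n IH].
- simpl. replace (1 - 1 - (w - z) * (0 * 1))%C with (RtoC 0) by ring. rewrite Cmod_0. lra.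
- set (T := (w ^ n - z ^ n - (w - z) * (INR n * z ^ pred n))%C) in *.
  replace (w ^ S n - z ^ S n - (w - z) * (INR (S n) * z ^ pred (S n)))%C
    with (w * T + (w - z) * (w - z) * (INR n * z ^ (pred n)))%C.
  2:{ unfold T. rewrite S_INR, RtoC_plus. destruct n; simpl; ring. }
  assert (B : rho * Cmod (INR n * z ^ pred n) <= INR n * rho ^ n).
  { rewrite Cmod_mult, Cmod_R, Cmod_pow, Rabs_pos_eq by apply pos_INR.
    destruct n as [|n]; [simpl; lra|]. change (pred (S n)) with n.
    assert (Cmod z ^ n <= rho ^ n) by (apply pow_incr; auto).
    change (rho ^ S n) with (rho * rho ^ n). 
    replace (rho * (INR (S n) * Cmod z ^ n)) with (INR (S n) * rho * Cmod z ^ n) by ring.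
    rewrite <- Rmult_assoc. apply Rmult_le_compat_l; auto. apply Rmult_le_pos; [apply pos_INR|lra]. }
  set (D := Cmod (w - z)) in *. assert (HD : 0 <= D) by apply Cmod_ge_0.
  assert (Tr : Cmod (w * T + (w - z) * (w - z) * (INR n * z ^ pred n)) <= rho * Cmod T + D * D * Cmod (INR n * z ^ pred n)).
  { eapply Rle_trans; [apply Cmod_triangle|]. rewrite !Cmod_mult. fold D.
    apply Rplus_le_compat_r. apply Rmult_le_compat_r; [apply Cmod_ge_0|auto]. }
  set (X := Cmod (INR n * z ^ pred n)) in *. set (Y := Cmod T) in *. clearbody X Y D.
  assert (Hrho : 0 <= rho) by lra. pose proof (pos_INR n). rewrite S_INR.
  assert (Hp : 0 <= rho ^ n) by (apply pow_le; lra). set (p := rho ^ n) in *.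
  change (rho ^ S n) with (rho * p). clearbody p.
  set (m := INR n) in *. clearbody m.
  apply Rle_trans with (rho * (rho * rho * Y) + rho * D * D * (rho * X)).
  { assert (0 <= rho * rho) by nra. nra. }
  apply Rle_trans with (rho * (m * m * p * (D * D)) + rho * D * D * (m * p)).
  { apply Rplus_le_compat; apply Rmult_le_compat_l; auto. repeat apply Rmult_le_pos; auto. }
  assert (0 <= rho * p * (D * D)) by (repeat apply Rmult_le_pos; auto). nra.
Qed.

Lemma psum_taylor2 (a : nat -> C) (z w : C) (rho : R) (n : nat) : Cmod z <= rho -> Cmod w <= rho ->
  rho * rho * Cmod (psum a w (S n) - psum a z (S n) - (w - z) * psum (dcoef a) z n)
  <= rsum (fun k => Cmod (INR k * (INR k * a k)) * rho ^ k) (S n) * (Cmod (w - z) * Cmod (w - z)).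
Proof.
intros Hz Hw. induction n as [|n IH].
- simpl. replace (0 + a O * 1 - (0 + a O * 1) - (w - z) * 0)%C with (RtoC 0) by ring.
  rewrite Cmod_0. rewrite !Cmod_mult, Cmod_0. lra.
- set (P := psum a w (S n)) in *. set (Q := psum a z (S n)) in *. set (D := psum (dcoef a) z n) in *.
  change (psum a w (S (S n))) with (P + a (S n) * w ^ (S n))%C.
  change (psum a z (S (S n))) with (Q + a (S n) * z ^ (S n))%C.
  change (psum (dcoef a) z (S n)) with (D + (INR (S n) * a (S n)) * z ^ n)%C.
  replace (P + a (S n) * w ^ S n - (Q + a (S n) * z ^ S n) - (w - z) * (D + INR (S n) * a (S n) * z ^ n))%C
    with ((P - Q - (w - z) * D) + a (S n) * (w ^ S n - z ^ S n - (w - z) * (INR (S n) * z ^ (pred (S n)))))%C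
    by (change (pred (S n)) with n; ring).
  assert (B := pow_taylor2 z w rho (S n) Hz Hw).
  set (T := (w ^ S n - z ^ S n - (w - z) * (INR (S n) * z ^ (pred (S n))))%C) in *.
  assert (Tr : Cmod (P - Q - (w - z) * D + a (S n) * T) <= Cmod (P - Q - (w - z) * D) + Cmod (a (S n)) * Cmod T).
  { eapply Rle_trans; [apply Cmod_triangle|]. rewrite Cmod_mult. lra. }
  set (u := fun k => Cmod (INR k * (INR k * a k)) * rho ^ k) in *.
  change (rsum u (S (S n))) with (rsum u (S n) + u (S n)).
  assert (Hu : u (S n) = Cmod (a (S n)) * (INR (S n) * INR (S n) * rho ^ (S n))).
  { unfold u. rewrite !Cmod_mult, !Cmod_R, !Rabs_pos_eq by apply pos_INR. ring. }
  rewrite Hu. pose proof (Cmod_ge_0 (a (S n))). pose proof (Cmod_ge_0 z).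
  assert (0 <= rho * rho) by nra. nra.
Qed.

(** The second-order Taylor remainders of the partial sums have a common quadratic
    bound, which passes to the limit. *)
Theorem is_cderiv_csum (a : nat -> C) (z : C) : disc_bounded a -> Cmod z < 1 ->
  is_cderiv (csum a) z (csum (dcoef a) z).
Proof.
intros H Hz. pose proof (Cmod_ge_0 z).
set (rho := (1 + Cmod z) / 2). assert (Hr : Cmod z < rho < 1) by (unfold rho; lra).
assert (Hrr : 0 < rho * rho) by (apply Rmult_lt_0_compat; lra).
destruct (disc_bounded_rsum _ rho (disc_bounded_mul_INR _ (disc_bounded_mul_INR a H)) ltac:(lra)) as [K [HK0 HK]].
assert (Q : forall w, Cmod w <= rho ->
  rho * rho * Cmod (csum a w - csum a z - (w - z) * csum (dcoef a) z) <= K * (Cmod (w - z) * Cmod (w - z))).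
{ intros w Hw.
  apply Rle_plus_epsilon. intros eps He.
  assert (C1 := csum_correct a w H ltac:(lra)). assert (C2 := csum_correct a z H ltac:(lra)).
  assert (C3 := csum_correct _ z (disc_bounded_dcoef a H) ltac:(lra)).
  rewrite is_cpseries_Cmod in C1, C2, C3.
  set (e := eps / (1 + 1 + 2)). assert (Hep : 0 < e) by (unfold e; lra).
  destruct (C1 e Hep) as [N1 H1]. destruct (C2 e Hep) as [N2 H2]. destruct (C3 e Hep) as [N3 H3].
  set (n := (N1 + N2 + N3)%nat).
  specialize (H1 (S n) ltac:(lia)). specialize (H2 (S n) ltac:(lia)). specialize (H3 n ltac:(lia)).
  assert (T := psum_taylor2 a z w rho n ltac:(lra) Hw). specialize (HK (S n)).
  assert (Hwz : Cmod (w - z) <= 2).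
  { unfold Cminus. eapply Rle_trans; [apply Cmod_triangle|]. rewrite Cmod_opp. lra. }
  set (d := (psum a w (S n) - psum a z (S n) - (w - z) * psum (dcoef a) z n)%C) in *.
  assert (Tr : Cmod (csum a w - csum a z - (w - z) * csum (dcoef a) z) <=
    Cmod d + (Cmod (psum a w (S n) - csum a w) + (Cmod (psum a z (S n) - csum a z) + Cmod (w - z) * Cmod (psum (dcoef a) z n - csum (dcoef a) z)))).
  { replace (csum a w - csum a z - (w - z) * csum (dcoef a) z)%C
     with (d + (- (psum a w (S n) - csum a w) + ((psum a z (S n) - csum a z) + (w - z) * (psum (dcoef a) z n - csum (dcoef a) z))))%C by (unfold d; ring).
    eapply Rle_trans; [apply Cmod_triangle|]. apply Rplus_le_compat_l.
    eapply Rle_trans; [apply Cmod_triangle|]. rewrite Cmod_opp. apply Rplus_le_compat_l.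
    eapply Rle_trans; [apply Cmod_triangle|]. rewrite Cmod_mult. lra. }
  pose proof (Cmod_ge_0 (w - z)) as Hp. pose proof (Cmod_ge_0 (psum (dcoef a) z n - csum (dcoef a) z)).
  assert (Tr2 : Cmod (csum a w - csum a z - (w - z) * csum (dcoef a) z) <= Cmod d + eps).
  { assert (Cmod (w - z) * Cmod (psum (dcoef a) z n - csum (dcoef a) z) <= 2 * e) by nra. unfold e in *. lra. }
  assert (rho * rho <= 1) by nra.
  assert (0 <= Cmod (w - z) * Cmod (w - z)) by nra.
  set (W := Cmod (w - z) * Cmod (w - z)) in *.
  apply Rle_trans with (rho * rho * Cmod d + eps); [nra|].
  apply Rplus_le_compat_r. eapply Rle_trans; [exact T|]. apply Rmult_le_compat_r; auto. }
apply is_cderiv_Cmod. intros eps He.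
exists (Rmin (rho - Cmod z) (eps * (rho * rho) / (K + 1))).
split. { apply Rmin_pos; [lra|]. apply Rdiv_lt_0_compat; [|lra]. apply Rmult_lt_0_compat; auto. }
intros w Hw.
assert (Hw1 := Rlt_le_trans _ _ _ Hw (Rmin_l _ _)).
assert (Hw2 := Rlt_le_trans _ _ _ Hw (Rmin_r _ _)).
assert (Hwr : Cmod w <= rho).
{ replace w with ((w - z) + z)%C by ring. eapply Rle_trans; [apply Cmod_triangle|lra]. }
specialize (Q w Hwr). pose proof (Cmod_ge_0 (w - z)) as Hp. set (D := Cmod (w - z)) in *.
apply Rmult_lt_compat_r with (r := K + 1) in Hw2; [|lra].
unfold Rdiv in Hw2. rewrite Rmult_assoc, Rinv_l, Rmult_1_r in Hw2 by lra.
apply Rmult_le_reg_l with (rho * rho); [auto|]. nra.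
Qed.

Lemma csum_holomorphic (a : nat -> C) : disc_bounded a -> disc_holomorphic (csum a).
Proof. intros H z Hz. eexists. apply is_cderiv_csum; auto. Qed.

(** Everything holomorphic on the disc can thus be handled through coefficients;
    in particular it is infinitely differentiable. *)
Theorem holomorphic_csum (f : C -> C) : disc_holomorphic f ->
  exists a, disc_bounded a /\ forall z, Cmod z < 1 -> f z = csum a z.
Proof.
intros H. exists (cauchy_coef f). assert (E := cauchy_expansion f H). split.
- apply disc_bounded_of_cpseries. intros z Hz. eexists. apply E, Hz.
- intros z Hz. symmetry. apply is_cpseries_csum, E, Hz.
Qed.

(** * Logarithmic coefficients *)

Lemma ccont_punctured_eq (f g : C -> C) (d : R) : 0 < d -> ccont f 0 -> ccont g 0 ->
  (forall z : C, z <> 0 -> Cmod z < d -> f z = g z) -> f 0 = g 0.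
Proof.
intros Hd Hf Hg H. rewrite ccont_Cmod in Hf, Hg.
destruct (Req_dec (Cmod (f 0 - g 0)) 0) as [E|E].
- apply Cmod_eq_0 in E. replace (f 0) with (f 0 - g 0 + g 0)%C by ring. rewrite E. ring.
- exfalso. pose proof (Cmod_ge_0 (f 0 - g 0)). set (e := Cmod (f 0 - g 0)) in *.
  destruct (Hf (e / 2) ltac:(lra)) as [d1 [Hd1 H1]].
  destruct (Hg (e / 2) ltac:(lra)) as [d2 [Hd2 H2]].
  set (m := Rmin d (Rmin d1 d2) / 2).
  assert (Hm : 0 < Rmin d (Rmin d1 d2)) by (repeat apply Rmin_pos; auto).
  assert (Hm1 : m < d) by (unfold m; pose proof (Rmin_l d (Rmin d1 d2)); lra).
  assert (Hm2 : m < Rmin d1 d2) by (unfold m; pose proof (Rmin_r d (Rmin d1 d2)); lra).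
  pose proof (Rmin_l d1 d2). pose proof (Rmin_r d1 d2).
  assert (Hc : Cmod m = m) by (rewrite Cmod_R, Rabs_pos_eq; [reflexivity|unfold m; lra]).
  assert (Hz : Cmod (m - 0) = m) by (replace (m - 0)%C with (RtoC m) by ring; exact Hc).
  specialize (H1 m ltac:(lra)). specialize (H2 m ltac:(lra)).
  rewrite <- (H m) in H2; [|apply Cmod_neq_0; unfold m in *; lra|lra].
  assert (e <= Cmod (f m - f 0) + Cmod (f m - g 0)).
  { unfold e. replace (f 0 - g 0)%C with (- (f m - f 0) + (f m - g 0))%C by ring.
    eapply Rle_trans; [apply Cmod_triangle|]. rewrite Cmod_opp. lra. }
  lra.
Qed.

Lemma cancel_variable (c : C) (S : C -> C) (d : R) : 0 < d -> ccont S 0 ->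
  (forall z : C, z <> 0 -> Cmod z < d -> (c + z * S z = 0)%C) ->
  c = 0 /\ forall z : C, z <> 0 -> Cmod z < d -> S z = 0.
Proof.
intros Hd HS H.
assert (Hc : c = 0).
{ assert (K := ccont_punctured_eq (fun z => c + z * S z)%C (fun _ => 0) d Hd).
  cbv beta in K. replace (c + 0 * S 0)%C with c in K by ring. apply K; auto.
  - apply ccont_plus; [apply ccont_const|]. apply ccont_mult; [apply ccont_id|exact HS].
  - apply ccont_const. }
split; [exact Hc|]. intros z Hz Hzd. specialize (H z Hz Hzd). rewrite Hc in H.
replace (S z) with (/ z * (0 + z * S z))%C by (field; auto). rewrite H. ring.
Qed.

(** A Taylor polynomial whose remainder is a continuous multiple of [z^3] is
    determined by the function, since [z] can be cancelled off the origin. *)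
Lemma jet_zero (c0 c1 c2 : C) (T : C -> C) (d : R) : 0 < d -> ccont T 0 ->
  (forall z : C, z <> 0 -> Cmod z < d -> (c0 + z * (c1 + z * (c2 + z * T z)) = 0)%C) ->
  c0 = 0 /\ c1 = 0 /\ c2 = 0.
Proof.
intros Hd HT H.
assert (C2 : ccont (fun z => c2 + z * T z)%C 0).
{ apply ccont_plus; [apply ccont_const|]. apply ccont_mult; [apply ccont_id|exact HT]. }
assert (C1 : ccont (fun z => c1 + z * (c2 + z * T z))%C 0).
{ apply ccont_plus; [apply ccont_const|]. apply ccont_mult; [apply ccont_id|exact C2]. }
destruct (cancel_variable c0 _ d Hd C1 H) as [H0 H0'].
destruct (cancel_variable c1 _ d Hd C2 H0') as [H1 H1'].
destruct (cancel_variable c2 _ d Hd HT H1') as [H2 _]. auto.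
Qed.

Lemma csum_ccont_0 (a : nat -> C) : disc_bounded a -> ccont (csum a) 0.
Proof. intros H. apply ex_cderiv_ccont, csum_holomorphic; [exact H|]. rewrite Cmod_0. lra. Qed.

Lemma csum_jet (a : nat -> C) (z : C) : disc_bounded a -> Cmod z < 1 ->
  csum a z = (a O + z * (a 1%nat + z * (a 2%nat + z * csum (shift (shift (shift a))) z)))%C.
Proof.
intros H Hz. 
rewrite csum_shift, (csum_shift (shift a)), (csum_shift (shift (shift a)));
auto using disc_bounded_shift.
Qed.

(** Comparing coefficients in the logarithmic derivative [h' = h F'] of
    [h = exp F]. *)
Lemma exp_coefficients (A B : nat -> C) : disc_bounded A -> disc_bounded B -> A O = 1 ->
  (forall z, Cmod z < 1 -> Cexp (csum B z) = csum A z) ->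
  A 1%nat = B 1%nat /\ (2 * A 2%nat = 2 * B 2%nat + A 1%nat * B 1%nat)%C /\
  (3 * A 3%nat = 3 * B 3%nat + 2 * (A 1%nat * B 2%nat) + A 2%nat * B 1%nat)%C.
Proof.
intros HA HB A0 H.
assert (DA := disc_bounded_dcoef A HA). assert (DB := disc_bounded_dcoef B HB).
assert (E : forall z, Cmod z < 1 -> csum (dcoef A) z = (csum (dcoef B) z * csum A z)%C).
{ intros z Hz. rewrite <- (is_C_derive_unique (csum A) z _ (is_cderiv_csum A z HA Hz)).
  apply is_C_derive_unique.
  apply (is_cderiv_ext_near (fun w => Cexp (csum B w)) _ z _ (1 - Cmod z)); [lra| |].
  - intros w Hw. apply H. replace w with ((w - z) + z)%C by ring.
    eapply Rle_lt_trans; [apply Cmod_triangle|lra].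
  - rewrite <- H by auto. apply is_cderiv_comp; [apply is_cderiv_Cexp|apply is_cderiv_csum; auto]. }
set (X := csum (shift (shift (shift (dcoef A))))).
set (Y := csum (shift (shift (shift (dcoef B))))).
set (Z := csum (shift (shift (shift A)))).
assert (CX : ccont X 0) by (apply csum_ccont_0; repeat apply disc_bounded_shift; auto).
assert (CY : ccont Y 0) by (apply csum_ccont_0; repeat apply disc_bounded_shift; auto).
assert (CZ : ccont Z 0) by (apply csum_ccont_0; repeat apply disc_bounded_shift; auto).
set (x0 := dcoef A 0%nat). set (x1 := dcoef A 1%nat). set (x2 := dcoef A 2%nat).
set (y0 := dcoef B 0%nat). set (y1 := dcoef B 1%nat). set (y2 := dcoef B 2%nat).
assert (J : (x0 - y0 * A O = 0 /\ x1 - (y0 * A 1%nat + y1 * A O) = 0 /\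
  x2 - (y0 * A 2%nat + y1 * A 1%nat + y2 * A O) = 0)%C).
{ apply (jet_zero _ _ _ (fun z => X z + (-(1)) * (y0 * Z z + y1 * (A 2%nat + z * Z z)
     + y2 * (A 1%nat + z * (A 2%nat + z * Z z)) + Y z * (A O + z * (A 1%nat + z * (A 2%nat + z * Z z)))))%C 1); [lra| |].
  - clearbody X Y Z. ccont_tac.
  - intros z _ Hz. specialize (E z Hz). rewrite (csum_jet (dcoef A)), (csum_jet (dcoef B)), (csum_jet A) in E by auto.
    fold X Y Z x0 x1 x2 y0 y1 y2 in E.
    match type of E with ?l = ?r => transitivity (l - r)%C; [ring|rewrite E; ring] end. }
destruct J as (J0 & J1 & J2).
unfold x0, x1, x2, y0, y1, y2, dcoef in *. rewrite A0 in *. simpl in J0, J1, J2.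
replace (1 + 1 + 1)%R with 3 in * by ring. replace (1 + 1)%R with 2 in * by ring.
assert (S : forall u v : C, (u - v = 0)%C -> u = v).
{ intros u v Huv. replace u with (u - v + v)%C by ring. rewrite Huv. ring. }
apply S in J0, J1, J2. repeat split.
- transitivity (1 * A 1%nat)%C; [ring|rewrite J0; ring].
- rewrite J1. ring.
- rewrite J2. ring.
Qed.

Lemma psum_scale (a : nat -> C) (r z : C) (n : nat) :
  psum (fun n => a n * r ^ n)%C z n = psum a (r * z) n.
Proof.
induction n as [|n IH]; simpl; [reflexivity|]. rewrite IH, Cpow_mult_l. ring.
Qed.

Lemma is_cpseries_scale (a : nat -> C) (r z l : C) :
  is_cpseries (fun n => a n * r ^ n)%C z l <-> is_cpseries a (r * z) l.
Proof.
rewrite !is_cpseries_Cmod. split; intros H eps He; destruct (H eps He) as [N HN];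
exists N; intros n Hn; specialize (HN n Hn); now rewrite psum_scale in *.
Qed.

Definition log_series (gamma : nat -> C) (n : nat) : C :=
  match n with O => 0 | S _ => (2 * gamma n)%C end.

(** The expansion of the logarithm holds on some disc of radius [r] only, so both
    sides of [f / z = exp F] are rescaled by [r] to the unit disc; the powers of
    [r] cancel in the relations between the coefficients. *)
Lemma hankel_of_coefficients (f : C -> C) (a gamma : nat -> C) : disc_bounded a ->
  a 0%nat = 0 -> a 1%nat = 1 -> (forall z, Cmod z < 1 -> f z = csum a z) ->
  log_coefficients f gamma ->
  (4 * hankel_2_1 gamma = a 2%nat * a 4%nat - a 3%nat ^ 2 + / 12 * a 2%nat ^ 4)%C.
Proof.
intros Ha a0 a1 Hf (r & F & Hr & (F0 & _ & FE) & FS).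
set (A := fun n => (shift a n * RtoC r ^ n)%C).
set (B := fun n => (log_series gamma n * RtoC r ^ n)%C).
assert (Hrz : forall z, Cmod z < 1 -> Cmod (r * z) < r).
{ intros z Hz. rewrite Cmod_mult, Cmod_R, Rabs_pos_eq by lra. pose proof (Cmod_ge_0 z). nra. }
assert (SB : forall z, Cmod z < 1 -> is_cpseries B z (F (r * z)%C)).
{ intros z Hz. apply is_cpseries_scale. apply (FS (r * z)%C (Hrz z Hz)). }
assert (HB : disc_bounded B) by (apply disc_bounded_of_cpseries; intros z Hz; eexists; apply SB, Hz).
assert (SA : forall z, Cmod z < 1 -> is_cpseries A z (csum (shift a) (r * z))).
{ intros z Hz. apply is_cpseries_scale, csum_correct; [apply disc_bounded_shift, Ha|].
  specialize (Hrz z Hz). lra. }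
assert (HA : disc_bounded A) by (apply disc_bounded_of_cpseries; intros z Hz; eexists; apply SA, Hz).
assert (A0 : A 0%nat = 1) by (unfold A, shift; rewrite a1; simpl; ring).
assert (E : forall z, Cmod z < 1 -> Cexp (csum B z) = csum A z).
{ intros z Hz. rewrite (is_cpseries_csum _ _ _ (SB z Hz)), (is_cpseries_csum _ _ _ (SA z Hz)).
  destruct (Ceq_dec z 0) as [->|Hz0].
  - replace (r * 0)%C with (RtoC 0) by ring. rewrite F0, Cexp_0, csum_0 by (apply disc_bounded_shift, Ha).
    unfold shift. now rewrite a1.
  - assert (Hrz0 : (r * z)%C <> 0).
    { apply Cmult_neq_0; auto. intros H. apply RtoC_inj in H. lra. }
    specialize (Hrz z Hz).
    rewrite FE, Hf, csum_shift, a0; auto; try lra. field.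
    split; auto. intros H. apply RtoC_inj in H. lra. }
destruct (exp_coefficients A B HA HB A0 E) as (E1 & E2 & E3).
unfold A, B, shift, log_series in E1, E2, E3.
assert (Hr0 : RtoC r <> 0) by (intros H; apply RtoC_inj in H; lra).
set (g1 := gamma 1%nat) in *. set (g2 := gamma 2%nat) in *. set (g3 := gamma 3%nat) in *.
set (a2 := a 2%nat) in *. set (a3 := a 3%nat) in *. set (a4 := a 4%nat) in *.
assert (G1 : g1 = (a2 / 2)%C).
{ transitivity (2 * g1 * r ^ 1 / (2 * r))%C; [simpl; field; auto|]. rewrite <- E1. simpl. field; auto. }
assert (G2 : g2 = (a3 / 2 - a2 ^ 2 / 4)%C).
{ transitivity ((2 * (2 * g2 * r ^ 2) + a2 * r ^ 1 * (2 * g1 * r ^ 1)) / (4 * r ^ 2) - a2 * g1 / 2)%C; [simpl; field; auto|].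
  rewrite <- E2, G1. simpl. field; auto. }
assert (G3 : g3 = (a4 / 2 - a2 * a3 / 2 + a2 ^ 3 / 6)%C).
{ transitivity ((3 * (2 * g3 * r ^ 3) + 2 * (a2 * r ^ 1 * (2 * g2 * r ^ 2)) + a3 * r ^ 2 * (2 * g1 * r ^ 1)) / (6 * r ^ 3)
     - (4 * a2 * g2 + 2 * a3 * g1) / 6)%C; [simpl; field; auto|].
  rewrite <- E3, G1, G2. simpl. field; auto. }
unfold hankel_2_1. fold g1 g2 g3. rewrite G1, G2, G3. simpl. field.
Qed.

(** * Coefficients of functions with positive real part *)

Lemma Re_cmean_ge_0 (g : C -> C) (r : R) : 0 <= r -> ccont_circle g r ->
  (forall w, Cmod w = r -> 0 <= Re (g w)) -> 0 <= Re (cmean g r).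
Proof.
intros Hr Hg H. unfold cmean. pose proof twoPI_pos.
rewrite <- RtoC_inv by lra. unfold CInt. simpl. rewrite Rmult_0_l, Rminus_0_r.
apply Rmult_le_pos; [left; apply Rinv_0_lt_compat; lra|].
apply RInt_ge_0; [lra|apply ex_RInt_Re; [lra|apply pcont_on_circ; auto]|].
intros t _. apply H, Cmod_circ, Hr.
Qed.

Lemma Cmult_Cconj (z : C) : (z * Cconj z)%C = RtoC (Cmod z ^ 2).
Proof. rewrite RtoC_pow. symmetry. rewrite <- RtoC_pow. apply Cmod2_conj. Qed.

Section Toeplitz.
Context (c : nat -> C) (Hc : disc_bounded c) (c0 : c O = 1).
Context (Hre : forall z, Cmod z < 1 -> 0 < Re (csum c z)).
Context (u0 u1 u2 u3 : C).

Let e1 : C := (u1 + c 1%nat * u0)%C.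
Let e2 : C := (u2 + c 1%nat * u1 + c 2%nat * u0)%C.
Let e3 : C := (u3 + c 1%nat * u2 + c 2%nat * u1 + c 3%nat * u0)%C.

(** With [q = u0 + u1 w + u2 w^2 + u3 w^3], the mean of [p |q|^2] over the
    circle only sees the terms in which the powers of [w] cancel. *)
Lemma toeplitz_radius (r : R) : 0 < r < 1 ->
  0 <= Re (u0 * Cconj u0 + e1 * Cconj u1 * RtoC r ^ 2 + e2 * Cconj u2 * RtoC r ^ 4
           + e3 * Cconj u3 * RtoC r ^ 6)%C.
Proof.
intros Hr.
set (P := csum (shift (shift (shift (shift c))))).
set (q := fun w => (u0 + w * (u1 + w * (u2 + w * u3)))%C).
set (k0 := Cconj u0). set (k1 := (Cconj u1 * RtoC r ^ 2)%C).
set (k2 := (Cconj u2 * RtoC r ^ 4)%C). set (k3 := (Cconj u3 * RtoC r ^ 6)%C).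
set (G := fun w => (P w * q w + (c 1%nat * u3 + c 2%nat * u2 + c 3%nat * u1
   + w * (c 2%nat * u3 + c 3%nat * u2 + w * (c 3%nat * u3))))%C).
set (H := fun w => (w * (e1 * k0 + e2 * k1 + e3 * k2 + w * (e2 * k0 + e3 * k1 + w * (e3 * k0))
   + G w * (k3 + w * (k2 + w * (k1 + w * k0)))))%C).
set (S := (u0 * k0 + e1 * k1 + e2 * k2 + e3 * k3)%C).
set (m1 := (u0 * k1 + e1 * k2 + e2 * k3)%C). set (m2 := (u0 * k2 + e1 * k3)%C). set (m3 := (u0 * k3)%C).
set (g := fun w => (csum c w * RtoC (Cmod (q w) ^ 2))%C).
set (h := fun w => (S + (H w + (m1 * / w ^ 1 + (m2 * / w ^ 2 + m3 * / w ^ 3))))%C).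
assert (HP : disc_holomorphic P) by (apply csum_holomorphic; repeat apply disc_bounded_shift; auto).
assert (HH : disc_holomorphic H).
{ intros w Hw. assert (HPw := HP w Hw). unfold H, G, q. clearbody P. ex_cderiv_tac. }
assert (Hp : forall w, Cmod w < 1 -> csum c w = (1 + w * (c 1%nat + w * (c 2%nat + w * (c 3%nat + w * P w))))%C).
{ intros w Hw. rewrite csum_jet by auto. rewrite (csum_shift (shift (shift (shift c)))) by (repeat apply disc_bounded_shift; auto).
  rewrite c0. reflexivity. }
(* On the circle [conj w = r^2 / w], so [p |q|^2] is a Laurent polynomial plus [H],
   and [H] vanishes at the origin. *)
assert (Hgh : forall w, Cmod w = r -> g w = h w).
{ intros w Hw. assert (Hw0 : w <> 0) by (apply Cmod_neq_0; lra).
  assert (Hcw : Cconj w = (RtoC r ^ 2 / w)%C).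
  { rewrite <- RtoC_pow, <- Hw, <- Cmult_Cconj. field. auto. }
  unfold g. rewrite <- Cmult_Cconj, Hp by lra. unfold q.
  rewrite !Cplus_conj, !Cmult_conj, !Cplus_conj, !Cmult_conj, !Cplus_conj, !Cmult_conj, Hcw.
  unfold h, S, H, G, m1, m2, m3, k0, k1, k2, k3, e1, e2, e3, q. field. auto. }
assert (Cinvp : forall k, ccont_circle (fun w => / w ^ k)%C r).
{ intros k w Hw. apply ccont_inv; [apply ccont_pow|]. apply Cpow_nz, Cmod_neq_0. lra. }
assert (CH : ccont_circle H r) by (intros w Hw; apply ex_cderiv_ccont, HH; lra).
assert (Cm : forall m k, ccont_circle (fun w => m * / w ^ k)%C r).
{ intros m k w Hw. apply (ccont_mult (fun _ => m) (fun w => / w ^ k)%C); [apply ccont_const|apply Cinvp, Hw]. }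
assert (C23 : ccont_circle (fun w => m2 * / w ^ 2 + m3 * / w ^ 3)%C r).
{ intros w Hw. apply (ccont_plus (fun w => m2 * / w ^ 2)%C (fun w => m3 * / w ^ 3)%C); apply Cm, Hw. }
assert (C123 : ccont_circle (fun w => m1 * / w ^ 1 + (m2 * / w ^ 2 + m3 * / w ^ 3))%C r).
{ intros w Hw. apply (ccont_plus (fun w => m1 * / w ^ 1)%C (fun w => m2 * / w ^ 2 + m3 * / w ^ 3)%C); [apply Cm, Hw|apply C23, Hw]. }
assert (CH123 : ccont_circle (fun w => H w + (m1 * / w ^ 1 + (m2 * / w ^ 2 + m3 * / w ^ 3)))%C r).
{ intros w Hw. apply (ccont_plus H (fun w => m1 * / w ^ 1 + (m2 * / w ^ 2 + m3 * / w ^ 3))%C); [apply CH, Hw|apply C123, Hw]. }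
assert (M : cmean g r = S).
{ rewrite (cmean_ext r ltac:(lra) g h Hgh). unfold h.
  rewrite (cmean_plus r ltac:(lra) (fun _ => S)); [|intros w _; apply ccont_const|exact CH123].
  rewrite cmean_const by lra.
  rewrite (cmean_plus r ltac:(lra) H) by auto.
  rewrite (cmean_value H 0 r ltac:(lra)).
  2:{ intros w Hw. apply ex_cderiv_ccont, HH, Hw. }
  2:{ intros w Hw _. apply HH, Hw. }
  rewrite (cmean_plus r ltac:(lra) (fun w => m1 * / w ^ 1)%C); [|apply Cm|exact C23].
  rewrite (cmean_plus r ltac:(lra) (fun w => m2 * / w ^ 2)%C) by apply Cm.
  rewrite !(cmean_scal r ltac:(lra)) by apply Cinvp.
  rewrite !cmean_inv_pow by (lra || lia). unfold H. ring. }
match goal with |- 0 <= Re ?x => replace x with S by (unfold S, k0, k1, k2, k3; ring) end.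
rewrite <- M. apply Re_cmean_ge_0; [lra| |].
- intros w Hw. apply (ccont_ext_near (fun w => csum c w * (q w * Cconj (q w)))%C g w 1); [lra| |].
  + intros v _. unfold g. now rewrite <- Cmult_Cconj.
  + apply ccont_mult; [apply ex_cderiv_ccont, csum_holomorphic; auto; lra|].
    assert (Cq : ccont q w) by (unfold q; ccont_tac).
    apply (ccont_mult q (fun w => Cconj (q w))); [exact Cq|].
    rewrite ccont_Cmod in *. intros eps He. destruct (Cq eps He) as [d [Hd Hq]].
    exists d. split; auto. intros v Hv. rewrite <- Cminus_conj, Cmod_conj. auto.
- intros w Hw. unfold g. specialize (Hre w ltac:(lra)).
  destruct (csum c w) as [x y]. simpl in *.
  assert (0 <= Cmod (q w) * Cmod (q w)) by (pose proof (Cmod_ge_0 (q w)); nra). nra.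
Qed.

(** Letting the radius tend to 1. *)
Lemma toeplitz : 0 <= Re (u0 * Cconj u0 + e1 * Cconj u1 + e2 * Cconj u2 + e3 * Cconj u3)%C.
Proof.
set (A := Re (u0 * Cconj u0)%C). set (B := Re (e1 * Cconj u1)%C).
set (D := Re (e2 * Cconj u2)%C). set (E := Re (e3 * Cconj u3)%C).
assert (HR : forall r, 0 < r < 1 -> 0 <= A + B * r ^ 2 + D * r ^ 4 + E * r ^ 6).
{ intros r Hr. assert (T := toeplitz_radius r Hr). rewrite <- !RtoC_pow in T.
  replace (A + B * r ^ 2 + D * r ^ 4 + E * r ^ 6) with
   (Re (u0 * Cconj u0 + e1 * Cconj u1 * (r ^ 2)%R + e2 * Cconj u2 * (r ^ 4)%R + e3 * Cconj u3 * (r ^ 6)%R)%C); [exact T|].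
  unfold A, B, D, E, Re, Cplus, Cmult, Cconj, RtoC. simpl. ring. }
replace (Re (u0 * Cconj u0 + e1 * Cconj u1 + e2 * Cconj u2 + e3 * Cconj u3)%C) with (A + B + D + E)
  by (unfold A, B, D, E, Re, Cplus; simpl; ring).
clearbody A B D E. destruct (Rle_dec 0 (A + B + D + E)) as [|Hn]; [auto|exfalso].
set (K := 6 * (Rabs B + Rabs D + Rabs E) + 1).
assert (HK : 1 <= K) by (unfold K; pose proof (Rabs_pos B); pose proof (Rabs_pos D); pose proof (Rabs_pos E); lra).
set (t := Rmin (/ 2) (- (A + B + D + E) / (2 * K))).
assert (Ht : 0 < t) by (apply Rmin_pos; [lra|apply Rdiv_lt_0_compat; lra]).
assert (Ht1 : t <= / 2) by apply Rmin_l.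
assert (Ht2 : t <= - (A + B + D + E) / (2 * K)) by apply Rmin_r.
assert (Ht3 : t * K <= - (A + B + D + E) / 2).
{ apply Rmult_le_compat_r with (r := K) in Ht2; [|lra].
  replace (- (A + B + D + E) / (2 * K) * K) with (- (A + B + D + E) / 2) in Ht2 by (field; lra). exact Ht2. }
specialize (HR (1 - t) ltac:(lra)).
assert (Q : forall X y, 0 <= y <= 6 * t -> X * (1 - y) <= X + Rabs X * (6 * t)).
{ intros X y Hy. assert (- X <= Rabs X) by (rewrite <- Rabs_Ropp; apply Rle_abs). pose proof (Rabs_pos X). nra. }
assert (P2 : 0 <= 1 - (1 - t) ^ 2 <= 2 * t) by (simpl; nra).
assert (P4 : 0 <= 1 - (1 - t) ^ 4 <= 4 * t).
{ replace ((1 - t) ^ 4) with ((1 - t) ^ 2 * (1 - t) ^ 2) by ring. set (x := (1 - t) ^ 2) in *. clearbody x. nra. }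
assert (P6 : 0 <= 1 - (1 - t) ^ 6 <= 6 * t).
{ replace ((1 - t) ^ 6) with ((1 - t) ^ 2 * (1 - t) ^ 4) by ring.
  set (x := (1 - t) ^ 2) in *. set (y := (1 - t) ^ 4) in *. clearbody x y. nra. }
assert (Q1 := Q B (1 - (1 - t) ^ 2) ltac:(lra)). assert (Q2 := Q D (1 - (1 - t) ^ 4) ltac:(lra)).
assert (Q3 := Q E (1 - (1 - t) ^ 6) ltac:(lra)).
replace (1 - (1 - (1 - t) ^ 2)) with ((1 - t) ^ 2) in Q1 by ring.
replace (1 - (1 - (1 - t) ^ 4)) with ((1 - t) ^ 4) in Q2 by ring.
replace (1 - (1 - (1 - t) ^ 6)) with ((1 - t) ^ 6) in Q3 by ring.
unfold K in Ht3. nra.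
Qed.

End Toeplitz.

Definition nsq (z : C) : R := Re z * Re z + Im z * Im z.

Lemma nsq_Cmod (z : C) : nsq z = Cmod z * Cmod z.
Proof. unfold nsq. pose proof (Cmod2_alt z) as H. simpl in H. lra. Qed.

(** The lower triangular Toeplitz matrix of the coefficients of
    [(p - 1) / (z (p + 1))] is a contraction: with [W] its strictly lower
    triangular extension, [P = (I + W) (I - W)^-1] is the matrix of
    multiplication by [p], and [Re <P u, u> = |v|^2 - |W v|^2] for
    [u = (I - W) v]. *)
Lemma schur_contraction (c : nat -> C) : disc_bounded c -> c O = 1 ->
  (forall z, Cmod z < 1 -> 0 < Re (csum c z)) ->
  forall v0 v1 v2 : C,
  let al := (c 1%nat / 2)%C in
  let be := (c 2%nat / 2 - c 1%nat ^ 2 / 4)%C in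
  let de := (c 3%nat / 2 - c 1%nat * c 2%nat / 2 + c 1%nat ^ 3 / 8)%C in
  nsq (al * v0) + nsq (be * v0 + al * v1) + nsq (de * v0 + be * v1 + al * v2)
  <= nsq v0 + nsq v1 + nsq v2.
Proof.
intros Hc c0 Hre v0 v1 v2 al be de.
assert (T := toeplitz c Hc c0 Hre v0 (v1 - al * v0)%C (v2 - (be * v0 + al * v1))%C (- (de * v0 + be * v1 + al * v2))%C).
replace (v1 - al * v0 + c 1%nat * v0)%C with (v1 + al * v0)%C in T by (unfold al; field).
replace (v2 - (be * v0 + al * v1) + c 1%nat * (v1 - al * v0) + c 2%nat * v0)%C
  with (v2 + (be * v0 + al * v1))%C in T by (unfold al, be; simpl; field).
replace (- (de * v0 + be * v1 + al * v2) + c 1%nat * (v2 - (be * v0 + al * v1)) + c 2%nat * (v1 - al * v0) + c 3%nat * v0)%C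
  with (de * v0 + be * v1 + al * v2)%C in T by (unfold al, be, de; simpl; field).
set (X := (al * v0)%C) in *. set (Y := (be * v0 + al * v1)%C) in *. set (Z := (de * v0 + be * v1 + al * v2)%C) in *.
clearbody X Y Z. destruct X, Y, Z, v0, v1, v2. unfold nsq. simpl in *. lra.
Qed.

(** The discriminant of a nonnegative quadratic polynomial, in a form that covers
    [m = 0]. *)
Lemma quadratic_nonneg (K m N : R) : 0 <= m -> 0 <= N ->
  (forall t, 0 <= K - 2 * t * N + m * (t * t) * N) -> N <= m * K.
Proof.
intros Hm HN H.
assert (K0 := H 0). 
destruct (Req_dec N 0) as [->|HN0]; [nra|].
destruct (Req_dec m 0) as [->|Hm0].
- specialize (H ((K + 1) / (2 * N))). 
  replace (K - 2 * ((K + 1) / (2 * N)) * N + 0 * ((K + 1) / (2 * N) * ((K + 1) / (2 * N))) * N) with (-1) in H by (field; auto). lra.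
- specialize (H (/ m)).
  replace (K - 2 * / m * N + m * (/ m * / m) * N) with (K - / m * N) in H by (field; auto).
  apply Rmult_le_reg_l with (/ m); [apply Rinv_0_lt_compat; lra|].
  rewrite <- Rmult_assoc, Rinv_l by auto. lra.
Qed.

(** Contractivity of the matrix means, by Schur's algorithm, that the first two
    coefficients bound the third one. *)
Lemma schur_bound (al be de : C) :
  (forall v0 v1 v2 : C,
    nsq (al * v0) + nsq (be * v0 + al * v1) + nsq (de * v0 + be * v1 + al * v2)
    <= nsq v0 + nsq v1 + nsq v2) ->
  let k := 1 - nsq al in
  0 <= k /\ nsq be <= k * k /\
  nsq (RtoC k * de + Cconj al * (be * be)) <= (k * k - nsq be) * (k * k - nsq be) /\
  (k = 0 -> de = 0).
Proof.
intros H k.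
assert (Hk : 0 <= k).
{ specialize (H 0 0 1). unfold k, nsq in *. destruct al, be, de. simpl in *. nra. }
destruct (Req_dec k 0) as [Hk0|Hk0].
{ specialize (H 1 0 0). unfold k, nsq in *. destruct al as [a1 a2], be as [b1 b2], de as [d1 d2]. simpl in *.
  assert (S : b1 * b1 + b2 * b2 + (d1 * d1 + d2 * d2) <= 0) by lra.
  assert (b1 = 0) by nra. assert (b2 = 0) by nra. assert (d1 = 0) by nra. assert (d2 = 0) by nra. subst.
  repeat split; try nra. }
assert (H2 : forall a b : C, nsq (de * a + be * b) + k * nsq (be * a + al * b) <= k * k * nsq a + k * nsq b).
{ (* The last entry maximizes [|Z + al v|^2 - |v|^2] over [v], where
     [Z = de v0 + be v1 = k X]. *)
  intros a b. specialize (H (RtoC k * a)%C (RtoC k * b)%C (Cconj al * (de * a + be * b))%C).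
  set (X := (de * a + be * b)%C) in *. set (Y := (be * a + al * b)%C).
  replace (de * (RtoC k * a) + be * (RtoC k * b) + al * (Cconj al * X))%C with X in H.
  2:{ transitivity ((RtoC k + al * Cconj al) * X)%C; [|unfold X; ring].
      replace (RtoC k + al * Cconj al)%C with (RtoC 1); [ring|].
      unfold k, nsq. destruct al. apply injective_projections; simpl; ring. }
  replace (be * (RtoC k * a) + al * (RtoC k * b))%C with (RtoC k * Y)%C in H by (unfold Y; ring).
  assert (S : forall z w, nsq (z * w) = nsq z * nsq w).
  { intros [z1 z2] [w1 w2]. unfold nsq. simpl. ring. }
  assert (Sk : nsq (RtoC k) = k * k) by (unfold nsq; simpl; ring).
  assert (Sa : nsq al = 1 - k) by (unfold k; ring).
  assert (Sc : nsq (Cconj al) = 1 - k) by (rewrite <- Sa; destruct al; unfold nsq; simpl; ring).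
  rewrite !S, Sk, Sa, Sc in H.
  apply Rmult_le_reg_l with k; lra. }
assert (Hm : nsq be <= k * k).
{ specialize (H2 0 1). unfold k, nsq in *. destruct al, be, de. simpl in *. nra. }
split; [exact Hk|]. split; [exact Hm|]. split; [|intros; contradiction].
(* [H2] at [(1, b)] is [K - 2 Re (y b) + m |b|^2 >= 0], whose minimum over [b] is
   attained at a multiple of [Cconj y] when [m > 0]. *)
set (m := k * k - nsq be).
set (y := (Cconj de * be + RtoC k * (Cconj be * al))%C).
set (K := k * k - nsq de - k * nsq be).
assert (Q : nsq y <= m * K).
{ apply quadratic_nonneg; [unfold m; lra|unfold nsq; nra|]. intros t.
  specialize (H2 1 (RtoC t * Cconj y)%C).
  replace (K - 2 * t * nsq y + m * (t * t) * nsq y) with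
   (k * k * nsq 1 + k * nsq (RtoC t * Cconj y) - (nsq (de * 1 + be * (RtoC t * Cconj y)) + k * nsq (be * 1 + al * (RtoC t * Cconj y)))); [lra|].
  unfold m, K, y, k, nsq. destruct al, be, de. simpl. ring. }
replace (nsq (RtoC k * de + Cconj al * (be * be))) with (m * m - (m * K - nsq y)); [lra|].
unfold m, K, y, k, nsq. destruct al, be, de. simpl. ring.
Qed.

(** The left-hand side increases with [b], the coefficient of [b^2] being
    [(1 - a) (64 - 17 a) / 1296]; for [b = k] it equals
    [k (4 / 81 - 13 a^2 / 1296 - 109 a^4 / 5184)]. *)
Lemma real_bound (a b k : R) : 0 <= a -> k = 1 - a * a -> 0 < k -> 0 <= b -> b <= k ->
  a * (k * k - b * b) / 16 + (a * a / 16 + 4 * k / 81) * (b * b) + 17 * k * (a * a) * b / 648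
    + 95 * k * (a * a * a * a) / 5184 <= k * (4 / 81).
Proof.
intros Ha Hk Hk0 Hb Hbk.
assert (Ha1 : a < 1) by nra.
assert (M : (1 - a) * (64 - 17 * a) / 1296 * (b * b) <= (1 - a) * (64 - 17 * a) / 1296 * (k * k)).
{ apply Rmult_le_compat_l; [|nra]. apply Rmult_le_pos; [apply Rmult_le_pos; lra|lra]. }
assert (M2 : 17 * k * (a * a) * b / 648 <= 17 * k * (a * a) * k / 648).
{ apply Rmult_le_compat_r; [lra|]. apply Rmult_le_compat_l; [|exact Hbk]. nra. }
apply Rle_trans with (a * (k * k) / 16 + (1 - a) * (64 - 17 * a) / 1296 * (k * k) + 17 * k * (a * a) * k / 648 + 95 * k * (a * a * a * a) / 5184).
{ subst k. lra. }
apply Rle_trans with (k * (4 / 81 - 13 * (a * a) / 1296 - 109 * (a * a * a * a) / 5184)).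
{ subst k. right. field. }
apply Rmult_le_compat_l; [lra|]. assert (0 <= a * a) by nra. nra.
Qed.

(** In the Schur coefficients the functional reads
    [al de / 16 + 17 / 648 al^2 be + 95 / 5184 al^4 - 4 / 81 be^2]. Multiplying by
    [k = 1 - |al|^2] allows [k de] to be expressed by the quantity that
    [schur_bound] controls, which leaves the inequality [real_bound] between
    moduli. *)
Lemma caratheodory_functional_bound (c : nat -> C) : disc_bounded c -> c O = 1 ->
  (forall z, Cmod z < 1 -> 0 < Re (csum c z)) ->
  Cmod (c 1%nat * c 3%nat / 64 - c 2%nat ^ 2 / 81 + c 1%nat ^ 4 / 3072) <= 4 / 81.
Proof.
intros Hc c0 Hre.
assert (T := schur_contraction c Hc c0 Hre). cbv zeta in T.
set (al := (c 1%nat / 2)%C) in *. set (be := (c 2%nat / 2 - c 1%nat ^ 2 / 4)%C) in *.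
set (de := (c 3%nat / 2 - c 1%nat * c 2%nat / 2 + c 1%nat ^ 3 / 8)%C) in *.
destruct (schur_bound al be de T) as (Hk & Hb & He & Hz). clear T.
set (k := 1 - nsq al) in *.
replace (c 1%nat * c 3%nat / 64 - c 2%nat ^ 2 / 81 + c 1%nat ^ 4 / 3072)%C
  with (al * de / 16 + RtoC (17 / 648) * (al * al * be) + RtoC (95 / 5184) * (al * al * (al * al)) - RtoC (4 / 81) * (be * be))%C.
2:{ unfold al, be, de. rewrite !RtoC_div by lra. simpl. field. }
rewrite !nsq_Cmod in *. pose proof (Cmod_ge_0 al) as Ha0. pose proof (Cmod_ge_0 be) as Hb0.
set (a := Cmod al) in *. set (b := Cmod be) in *.
destruct (Req_dec k 0) as [Hk0|Hk0].
- rewrite (Hz Hk0). rewrite Hk0 in Hb. assert (b = 0) by nra.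
  assert (B0 : be = 0) by (apply Cmod_eq_0; auto). rewrite B0.
  replace (al * 0 / 16 + RtoC (17 / 648) * (al * al * 0) + RtoC (95 / 5184) * (al * al * (al * al)) - RtoC (4 / 81) * (0 * 0))%C
   with (RtoC (95 / 5184) * (al * al * (al * al)))%C by field.
  rewrite !Cmod_mult, Cmod_R, Rabs_pos_eq by lra. fold a. 
  unfold k in Hk0. rewrite nsq_Cmod in Hk0. fold a in Hk0. replace (a * a) with 1 by lra. lra.
- assert (Hbk : b <= k) by nra.
  set (e := (RtoC k * de + Cconj al * (be * be))%C) in *.
  assert (Hek : Cmod e <= k * k - b * b).
  { pose proof (Cmod_ge_0 e). assert (0 <= k * k - b * b) by nra. nra. }
  assert (Hka : k = 1 - a * a) by (unfold k; rewrite nsq_Cmod; reflexivity).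
  assert (RB := real_bound a b k Ha0 Hka ltac:(lra) Hb0 Hbk).
  apply Rmult_le_reg_l with k; [lra|]. 
  replace k with (Cmod (RtoC k)) at 1 by (rewrite Cmod_R, Rabs_pos_eq; lra). rewrite <- Cmod_mult.
  assert (Haa : (al * Cconj al)%C = RtoC (a * a)).
  { rewrite Cmult_Cconj. fold a. f_equal. ring. }
  replace (RtoC k * (al * de / 16 + RtoC (17 / 648) * (al * al * be) + RtoC (95 / 5184) * (al * al * (al * al)) - RtoC (4 / 81) * (be * be)))%C
    with (RtoC (/ 16) * (al * e) + (RtoC (- (a * a / 16 + 4 * k / 81)) * (be * be)
      + (RtoC (17 * k / 648) * (al * al * be) + RtoC (95 * k / 5184) * (al * al * (al * al)))))%C.
  2:{ replace (al * e)%C with (RtoC k * (al * de) + (al * Cconj al) * (be * be))%C by (unfold e; ring).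
      rewrite Haa. rewrite !RtoC_opp, !RtoC_plus, !RtoC_div, !RtoC_mult, RtoC_inv by lra. field. }
  eapply Rle_trans; [apply Cmod_triangle|].
  eapply Rle_trans; [apply Rplus_le_compat_l, Cmod_triangle|].
  eapply Rle_trans; [apply Rplus_le_compat_l, Rplus_le_compat_l, Cmod_triangle|].
  rewrite !Cmod_mult, !Cmod_R. fold a b. rewrite Rabs_Ropp, !Rabs_pos_eq by nra.
  assert (a * Cmod e <= a * (k * k - b * b)) by (apply Rmult_le_compat_l; auto).
  lra.
Qed.

(** * The upper bound *)

Lemma is_cderiv_csum_ext (f : C -> C) (a : nat -> C) (z : C) : disc_bounded a ->
  (forall w, Cmod w < 1 -> f w = csum a w) -> Cmod z < 1 -> is_cderiv f z (csum (dcoef a) z).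
Proof.
intros Ha Hf Hz. apply (is_cderiv_ext_near (csum a) f z _ (1 - Cmod z)); [lra| |].
- intros w Hw. symmetry. apply Hf. replace w with ((w - z) + z)%C by ring.
  eapply Rle_lt_trans; [apply Cmod_triangle|lra].
- apply is_cderiv_csum; auto.
Qed.

Lemma psum_plus (a b : nat -> C) (z : C) (n : nat) :
  psum (fun k => a k + b k)%C z n = (psum a z n + psum b z n)%C.
Proof. induction n as [|n IH]; simpl; [ring|rewrite IH; ring]. Qed.

Lemma csum_plus (a b : nat -> C) (z : C) : disc_bounded a -> disc_bounded b -> Cmod z < 1 ->
  csum (fun k => a k + b k)%C z = (csum a z + csum b z)%C.
Proof.
intros Ha Hb Hz. apply is_cpseries_csum, is_cpseries_Cmod. intros eps He.
assert (A := csum_correct a z Ha Hz). assert (B := csum_correct b z Hb Hz).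
rewrite is_cpseries_Cmod in A, B.
destruct (A (eps / 2) ltac:(lra)) as [N1 H1]. destruct (B (eps / 2) ltac:(lra)) as [N2 H2].
exists (N1 + N2)%nat. intros n Hn. rewrite psum_plus.
specialize (H1 n ltac:(lia)). specialize (H2 n ltac:(lia)).
replace (psum a z n + psum b z n - (csum a z + csum b z))%C
  with ((psum a z n - csum a z) + (psum b z n - csum b z))%C by ring.
eapply Rle_lt_trans; [apply Cmod_triangle|lra].
Qed.

(** The operator [f |-> (z f')' = f' + z f''] multiplies the coefficient of
    [z^n] by [n^2] and lowers the degree by one. *)
Definition zcoef (a : nat -> C) : nat -> C := dcoef (fun n => INR n * a n)%C.

Lemma csum_zcoef (a : nat -> C) (z : C) : disc_bounded a -> Cmod z < 1 ->
  (csum (dcoef a) z + z * csum (dcoef (dcoef a)) z = csum (zcoef a) z)%C.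
Proof.
intros Ha Hz. assert (Hb := disc_bounded_dcoef a Ha). assert (Hc := disc_bounded_mul_INR _ Hb).
rewrite (csum_ext (zcoef a) (fun n => dcoef a n + INR n * dcoef a n)%C).
- rewrite csum_plus by auto. f_equal.
  rewrite (csum_shift (fun n => INR n * dcoef a n)%C) by auto. 
  change (shift (fun n => INR n * dcoef a n)%C) with (dcoef (dcoef a)). simpl. ring.
- intros n. unfold zcoef, dcoef. rewrite S_INR, RtoC_plus. ring.
Qed.

Lemma class_W1_operator (f : C -> C) (a : nat -> C) (z : C) : disc_bounded a ->
  (forall w, Cmod w < 1 -> f w = csum a w) -> Cmod z < 1 ->
  (C_derive f z + z * C_derive (C_derive f) z)%C = csum (zcoef a) z.
Proof.
intros Ha Hf Hz. rewrite <- csum_zcoef by auto.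
assert (D : forall w, Cmod w < 1 -> C_derive f w = csum (dcoef a) w).
{ intros w Hw. apply is_C_derive_unique. apply is_cderiv_csum_ext; auto. }
rewrite D by auto. f_equal. f_equal. apply is_C_derive_unique.
apply is_cderiv_csum_ext; auto. apply disc_bounded_dcoef, Ha.
Qed.

Lemma class_A_series (f : C -> C) : class_A f ->
  exists a, disc_bounded a /\ a 0%nat = 0 /\ a 1%nat = 1 /\ forall z, Cmod z < 1 -> f z = csum a z.
Proof.
intros (Hol & F0 & F1). destruct (holomorphic_csum f Hol) as [a [Ha Hf]].
assert (Z : Cmod 0 < 1) by (rewrite Cmod_0; lra).
exists a. repeat split; auto.
- rewrite <- F0, Hf, csum_0; auto.
- rewrite <- F1. symmetry. rewrite (is_C_derive_unique f 0 _ (is_cderiv_csum_ext f a 0 Ha Hf Z)).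
  rewrite csum_0 by (apply disc_bounded_dcoef, Ha). unfold dcoef. simpl. ring.
Qed.

Theorem hankel_bound (f : C -> C) (gamma : nat -> C) :
  class_W1 f -> log_coefficients f gamma -> Cmod (hankel_2_1 gamma) <= 1 / 81.
Proof.
intros [HA HW] Hg. destruct (class_A_series f HA) as (a & Ha & a0 & a1 & Hf).
assert (B := caratheodory_functional_bound (zcoef a) (disc_bounded_dcoef _ (disc_bounded_mul_INR a Ha))).
assert (H4 := hankel_of_coefficients f a gamma Ha a0 a1 Hf Hg).
assert (M : Cmod (4 * hankel_2_1 gamma) = 4 * Cmod (hankel_2_1 gamma)) by (rewrite Cmod_mult, Cmod_R, Rabs_pos_eq; lra).
assert (Cmod (4 * hankel_2_1 gamma) <= 4 / 81); [|lra].
rewrite H4.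
replace (a 2%nat * a 4%nat - a 3%nat ^ 2 + / 12 * a 2%nat ^ 4)%C
  with (zcoef a 1%nat * zcoef a 3%nat / 64 - zcoef a 2%nat ^ 2 / 81 + zcoef a 1%nat ^ 4 / 3072)%C.
- apply B.
  + unfold zcoef, dcoef. rewrite a1. simpl. ring.
  + intros z Hz. rewrite <- (class_W1_operator f a z Ha Hf Hz). apply HW, Hz.
- unfold zcoef, dcoef. simpl. rewrite !RtoC_plus. field.
Qed.

(** * Existence of the logarithm, and the extremal function *)

Lemma cderiv_zero_constant (K : C -> C) : (forall z, Cmod z < 1 -> is_cderiv K z 0) ->
  forall z, Cmod z < 1 -> K z = K 0.
Proof.
intros H z Hz. pose proof (Cmod_ge_0 z).
assert (Q : forall P : C -> R, (forall c, Rabs (P c) <= Cmod c) -> (forall c d, P (c - d)%C = P c - P d) ->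
  P (K (0 * z)%C) = P (K (1 * z)%C)).
{ intros P P1 P2. apply (eq_is_derive (fun t : R => P (K (t * z)%C)) 0 1); [|lra].
  intros t Ht. apply is_derive_Reals. intros eps He.
  assert (Htz : Cmod (t * z) < 1) by (rewrite Cmod_mult, Cmod_R, Rabs_pos_eq by lra; nra).
  assert (D := H _ Htz). rewrite is_cderiv_Cmod in D. destruct (D (eps / 2) ltac:(lra)) as [d [Hd D']].
  exists (mkposreal d Hd). intros h Hh Hhd. simpl in Hhd.
  assert (E : ((t + h)%R * z - t * z)%C = (h * z)%C) by (rewrite RtoC_plus; ring).
  assert (Hp : 0 < Rabs h) by (apply Rabs_pos_lt, Hh).
  specialize (D' ((t + h)%R * z)%C). rewrite E, Cmod_mult, Cmod_R in D'.
  specialize (D' ltac:(nra)). replace (h * z * 0)%C with (RtoC 0) in D' by ring.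
  (replace (K ((t + h)%R * z) - K (t * z) - 0)%C with (K ((t + h)%R * z) - K (t * z))%C in D' by ring).
  rewrite <- P2, Rminus_0_r, Rabs_div by exact Hh.
  apply Rle_lt_trans with (eps / 2); [|lra].
  apply Rmult_le_reg_r with (Rabs h); [exact Hp|]. unfold Rdiv at 1. rewrite Rmult_assoc, Rinv_l, Rmult_1_r by lra.
  eapply Rle_trans; [apply P1|]. eapply Rle_trans; [exact D'|].
  assert (Rabs h * Cmod z <= Rabs h) by nra. apply Rmult_le_compat_l; lra. }
replace (0 * z)%C with (RtoC 0) in Q by ring. replace (1 * z)%C with z in Q by ring.
assert (QR := Q Re re_le_Cmod ltac:(reflexivity)). assert (QI := Q Im im_le_Cmod ltac:(reflexivity)).
destruct (K z), (K 0). simpl in *. congruence.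
Qed.

Definition primitive_coef (d : nat -> C) (n : nat) : C :=
  match n with O => 0 | S m => (d m / INR (S m))%C end.

Lemma INR_S_neq_0 (n : nat) : RtoC (INR (S n)) <> 0.
Proof. intros H. apply RtoC_inj in H. apply (not_0_INR (S n)); [lia|exact H]. Qed.

Lemma dcoef_primitive (d : nat -> C) (n : nat) : dcoef (primitive_coef d) n = d n.
Proof. unfold dcoef, primitive_coef. pose proof (INR_S_neq_0 n). field. auto. Qed.

Lemma disc_bounded_primitive (d : nat -> C) : disc_bounded d -> disc_bounded (primitive_coef d).
Proof.
intros H rho Hr. destruct (H rho Hr) as [M HM].
assert (M0 : 0 <= M) by (specialize (HM O); simpl in HM; pose proof (Cmod_ge_0 (d O)); lra).
exists M. intros [|n]; unfold primitive_coef; [rewrite Cmod_0; lra|].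
specialize (HM n). rewrite Cmod_div, Cmod_R, Rabs_pos_eq by (apply INR_S_neq_0 || apply pos_INR).
pose proof (Cmod_ge_0 (d n)).
assert (I1 : 1 <= INR (S n)) by (rewrite S_INR; pose proof (pos_INR n); lra).
assert (B : Cmod (d n) / INR (S n) <= Cmod (d n)).
{ apply Rmult_le_reg_r with (INR (S n)); [lra|]. unfold Rdiv. rewrite Rmult_assoc, Rinv_l, Rmult_1_r by lra. nra. }
assert (P0 : 0 < rho ^ n) by (apply pow_lt; lra). change (rho ^ S n) with (rho * rho ^ n).
apply Rle_trans with (Cmod (d n) * (rho * rho ^ n)).
- apply Rmult_le_compat_r; [nra|exact B].
- assert (0 <= Cmod (d n) * rho ^ n) by nra. nra.
Qed.

(** On a disc where [h = f / z] does not vanish, a primitive of [h' / h] is a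
    logarithm of [h]. *)
Theorem log_coefficients_exist (f : C -> C) : class_A f -> exists gamma, log_coefficients f gamma.
Proof.
intros HA. destruct (class_A_series f HA) as (a & Ha & a0 & a1 & Hf).
set (h := csum (shift a)). assert (Hs := disc_bounded_shift a Ha).
assert (h0 : h 0 = 1) by (unfold h; rewrite csum_0 by auto; exact a1).
assert (Ch := csum_ccont_0 (shift a) Hs). fold h in Ch. rewrite ccont_Cmod in Ch.
destruct (Ch 1 ltac:(lra)) as [d0 [Hd0 Hd]].
set (r := Rmin d0 1). assert (Hr : 0 < r <= 1) by (split; [apply Rmin_pos; lra|apply Rmin_r]).
assert (Hnz : forall w, Cmod w < r -> h w <> 0).
{ intros w Hw E. specialize (Hd w). rewrite h0, E in Hd.
  replace (w - 0)%C with w in Hd by ring. replace (0 - 1)%C with (- (1))%C in Hd by ring.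
  rewrite Cmod_opp, Cmod_1 in Hd. assert (r <= d0) by apply Rmin_l. specialize (Hd ltac:(lra)). lra. }
assert (Hrz : forall z, Cmod z < 1 -> Cmod (r * z) < r).
{ intros z Hz. rewrite Cmod_mult, Cmod_R, Rabs_pos_eq by lra. pose proof (Cmod_ge_0 z). nra. }
assert (Dsc : forall z, is_cderiv (fun z => r * z)%C z (RtoC r)).
{ intros z. eapply is_cderiv_eq. apply is_cderiv_mult; [apply (is_cderiv_const r)|apply is_cderiv_id]. cbv beta. ring. }
assert (Dh : forall z, Cmod z < 1 -> is_cderiv (fun z => h (r * z)%C) z (r * csum (dcoef (shift a)) (r * z))%C).
{ intros z Hz. apply (is_cderiv_comp h (fun z => r * z)%C); [|apply Dsc].
  apply is_cderiv_csum; auto. specialize (Hrz z Hz). lra. }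
set (L := fun z => (r * csum (dcoef (shift a)) (r * z) / h (r * z))%C).
assert (HL : disc_holomorphic L).
{ intros z Hz. eexists. apply is_cderiv_div; [apply Hnz, Hrz, Hz| |apply Dh, Hz].
  apply is_cderiv_mult; [apply (is_cderiv_const r)|].
  apply (is_cderiv_comp (csum (dcoef (shift a))) (fun z => r * z)%C); [|apply Dsc].
  apply is_cderiv_csum; [apply disc_bounded_dcoef; auto|]. specialize (Hrz z Hz). lra. }
destruct (holomorphic_csum L HL) as [d [Hdb Hd1]].
set (B := primitive_coef d). assert (HB : disc_bounded B) by (apply disc_bounded_primitive, Hdb).
assert (DB : forall z, Cmod z < 1 -> is_cderiv (csum B) z (L z)).
{ intros z Hz. rewrite Hd1, <- (csum_ext _ d z (dcoef_primitive d)) by auto. apply is_cderiv_csum; auto. }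
assert (B0 : csum B 0 = 0) by (rewrite csum_0; auto).
assert (K : forall z, Cmod z < 1 -> (h (r * z) * Cexp (- csum B z) = 1)%C).
{ intros z Hz. rewrite (cderiv_zero_constant (fun z => h (r * z) * Cexp (- csum B z))%C); [| |exact Hz].
  - replace (r * 0)%C with (RtoC 0) by ring. rewrite h0, B0. replace (- 0)%C with (RtoC 0) by ring.
    rewrite Cexp_0. ring.
  - clear z Hz. intros z Hz. eapply is_cderiv_eq.
    + apply is_cderiv_mult; [apply Dh, Hz|].
      apply (is_cderiv_comp Cexp (fun z => - csum B z)%C); [apply is_cderiv_Cexp|apply is_cderiv_opp, DB, Hz].
    + unfold L. field. apply Hnz, Hrz, Hz. }
assert (Hexp : forall z, Cmod z < 1 -> Cexp (csum B z) = h (r * z)%C).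
{ intros z Hz. transitivity (h (r * z) * Cexp (- csum B z) * Cexp (csum B z))%C.
  - rewrite K by auto. ring.
  - rewrite <- Cmult_assoc, <- Cexp_plus. replace (- csum B z + csum B z)%C with (RtoC 0) by ring.
    rewrite Cexp_0. ring. }
assert (Hr0 : RtoC r <> 0) by (intros H; apply RtoC_inj in H; lra).
assert (Hwr : forall w, Cmod w < r -> Cmod (w / r) < 1).
{ intros w Hw. rewrite Cmod_div, Cmod_R, Rabs_pos_eq by (auto; lra).
  apply Rmult_lt_reg_r with r; [lra|]. unfold Rdiv. rewrite Rmult_assoc, Rinv_l; lra. }
exists (fun n => (B n / (2 * r ^ n))%C), r, (fun w => csum B (w / r)%C).
split; [exact Hr|]. split; [split; [|split]|].
- cbv beta. replace (0 / r)%C with (RtoC 0) by (field; auto). exact B0.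
- intros w Hw. apply ex_cderiv_ccont. eexists.
  apply (is_cderiv_comp (csum B) (fun w => w / r)%C); [apply DB, Hwr, Hw|].
  apply is_cderiv_div; [auto|apply is_cderiv_id|apply (is_cderiv_const r)].
- intros w Hw0 Hw. rewrite Hexp by auto. replace (r * (w / r))%C with w by (field; auto).
  rewrite Hf by lra. rewrite csum_shift, a0 by (auto; lra). fold h. field. auto.
- intros w Hw. 
  assert (S : is_cpseries (fun n => log_series (fun n => (B n / (2 * r ^ n))%C) n * r ^ n)%C (w / r)%C (csum B (w / r)%C)).
  { replace (csum B (w / r)) with (csum (fun n => log_series (fun n => (B n / (2 * r ^ n))%C) n * r ^ n)%C (w / r)).
    - apply csum_correct; [|auto]. apply (disc_bounded_le B); [exact HB|]. intros [|n].
      + simpl. replace (0 * 1)%C with (RtoC 0) by ring. lra.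
      + right. f_equal. unfold log_series. field. apply Cpow_nz, Hr0.
    - apply csum_ext. intros [|n]; [simpl; ring|]. unfold log_series. field. apply Cpow_nz, Hr0. }
  rewrite is_cpseries_scale in S. replace (r * (w / r))%C with w in S by (field; auto). exact S.
Qed.

Lemma Re_cayley_pos (w : C) : Cmod w < 1 -> 0 < Re ((1 + w) / (1 - w))%C.
Proof.
intros Hw. assert (H1 : (1 - w)%C <> 0).
{ intros E. replace w with (1 - (1 - w))%C in Hw by ring. rewrite E in Hw.
  replace (1 - 0)%C with (RtoC 1) in Hw by ring. rewrite Cmod_1 in Hw. lra. }
set (p := ((1 + w) / (1 - w))%C).
assert (E : (p * (1 - w) = 1 + w)%C) by (unfold p; field; auto).
assert (N : 0 < nsq (1 - w)) by (rewrite nsq_Cmod; apply Cmod_gt_0 in H1; nra).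
assert (Nw : nsq w < 1) by (rewrite nsq_Cmod; pose proof (Cmod_ge_0 w); nra).
assert (I : Re p * nsq (1 - w) = 1 - nsq w).
{ transitivity (Re (p * (1 - w) * Cconj (1 - w))%C).
  - destruct p, w. unfold nsq. simpl. ring.
  - rewrite E. destruct w. unfold nsq. simpl. ring. }
nra.
Qed.

(** For [(z f')' = (1 + z^2) / (1 - z^2) = 1 + 2 z^2 + ...] one has [a2 = 0] and
    [a3 = 2 / 9], so that the determinant is [- a3^2 / 4 = - 1 / 81]. *)
Theorem hankel_sharp : exists (f : C -> C) (gamma : nat -> C),
  class_W1 f /\ log_coefficients f gamma /\ Cmod (hankel_2_1 gamma) = 1 / 81.
Proof.
set (p := fun z => ((1 + z * z) / (1 - z * z))%C).
assert (Hzz : forall z, Cmod z < 1 -> Cmod (z * z) < 1).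
{ intros z Hz. rewrite Cmod_mult. pose proof (Cmod_ge_0 z). nra. }
assert (Hnz : forall z, Cmod z < 1 -> (1 - z * z)%C <> 0).
{ intros z Hz E. specialize (Hzz z Hz). replace (z * z)%C with (1 - (1 - z * z))%C in Hzz by ring.
  rewrite E in Hzz. replace (1 - 0)%C with (RtoC 1) in Hzz by ring. rewrite Cmod_1 in Hzz. lra. }
assert (Dsq : forall z : C, is_cderiv (fun z => z * z)%C z (1 * z + z * 1)%C).
{ intros z. apply is_cderiv_mult; apply is_cderiv_id. }
assert (Hp : disc_holomorphic p).
{ intros z Hz. eexists. apply is_cderiv_div; [apply Hnz, Hz| |].
  - apply is_cderiv_plus; [apply (is_cderiv_const 1)|apply Dsq].
  - apply is_cderiv_minus; [apply (is_cderiv_const 1)|apply Dsq]. }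
destruct (holomorphic_csum p Hp) as [c [Hc Hpc]].
assert (J : (c 0%nat - 1 = 0 /\ c 1%nat = 0 /\ c 2%nat - 2 = 0)%C).
{ apply (jet_zero _ _ _ (fun z => csum (shift (shift (shift c))) z + (- (2)) * (z * / (1 + (- (1)) * (z * z))))%C 1); [lra| |].
  - assert (C3 : ccont (csum (shift (shift (shift c)))) 0) by (apply csum_ccont_0; repeat apply disc_bounded_shift; auto).
    assert (Ci : ccont (fun z => / (1 + (- (1)) * (z * z)))%C 0).
    { apply (ccont_inv (fun z => 1 + (- (1)) * (z * z))%C); [ccont_tac|].
      replace (1 + - (1) * (0 * 0))%C with (RtoC 1) by ring. intros H. apply RtoC_inj in H. lra. }
    clear - C3 Ci. ccont_tac.
  - intros z _ Hz. assert (E := Hpc z Hz). rewrite csum_jet in E by auto.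
    specialize (Hnz z Hz).
    transitivity (p z - p z)%C; [rewrite E at 1; unfold p|ring].
    replace (1 + - (1) * (z * z))%C with (1 - z * z)%C by ring. field. exact Hnz. }
destruct J as (J0 & J1 & J2).
assert (c0 : c 0%nat = 1) by (replace (c 0%nat) with (c 0%nat - 1 + 1)%C by ring; rewrite J0; ring).
assert (c2 : c 2%nat = 2) by (replace (c 2%nat) with (c 2%nat - 2 + 2)%C by ring; rewrite J2; ring).
(* These coefficients make [(z f')' = p]. *)
set (a := fun n => match n with O => RtoC 0 | S m => (c m / (INR (S m) * INR (S m)))%C end).
assert (Ha : disc_bounded a).
{ apply (disc_bounded_le (primitive_coef c)); [apply disc_bounded_primitive, Hc|].
  intros [|n]; unfold a, primitive_coef; [lra|]. pose proof (INR_S_neq_0 n) as Hn.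
  replace (c n / (INR (S n) * INR (S n)))%C with (c n / INR (S n) * / INR (S n))%C by (field; auto).
  rewrite Cmod_mult, Cmod_inv, Cmod_R, Rabs_pos_eq by (auto using pos_INR).
  assert (I1 : 1 <= INR (S n)) by (rewrite S_INR; pose proof (pos_INR n); lra).
  assert (/ INR (S n) <= 1) by (rewrite <- Rinv_1; apply Rinv_le_contravar; lra).
  pose proof (Cmod_ge_0 (c n / INR (S n))). nra. }
assert (Hza : forall n, zcoef a n = c n).
{ intros n. unfold zcoef, dcoef, a. pose proof (INR_S_neq_0 n). field. auto. }
assert (a0 : a 0%nat = 0) by reflexivity.
assert (a1 : a 1%nat = 1) by (unfold a; rewrite c0; simpl; field).
assert (HA : class_A (csum a)).
{ split; [exact (csum_holomorphic a Ha)|]. split; [apply csum_0, Ha|].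
  rewrite (is_C_derive_unique (csum a) 0 _ (is_cderiv_csum a 0 Ha ltac:(rewrite Cmod_0; lra))).
  rewrite csum_0 by (apply disc_bounded_dcoef, Ha). unfold dcoef. rewrite a1. simpl. ring. }
destruct (log_coefficients_exist (csum a) HA) as [gamma Hg].
exists (csum a), gamma. split; [|split; [exact Hg|]].
- split; [exact HA|]. intros z Hz. rewrite (class_W1_operator (csum a) a z Ha ltac:(auto) Hz).
  rewrite (csum_ext _ c z Hza), <- Hpc by exact Hz. apply (Re_cayley_pos (z * z)), Hzz, Hz.
- assert (H4 := hankel_of_coefficients (csum a) a gamma Ha a0 a1 ltac:(auto) Hg).
  assert (E : hankel_2_1 gamma = RtoC (- (1 / 81))).
  { transitivity (4 * hankel_2_1 gamma / 4)%C; [field|]. rewrite H4. unfold a. rewrite J1, c2.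
    rewrite RtoC_opp, RtoC_div by lra. simpl INR. rewrite !RtoC_plus. field. }
  rewrite E, Cmod_R, Rabs_Ropp, Rabs_pos_eq; lra.
Qed.

Theorem theorem5p1 :
  (forall (f : C -> C) (gamma : nat -> C),
     class_W1 f -> log_coefficients f gamma ->
     Cmod (hankel_2_1 gamma) <= 1 / 81) /\
  (exists (f : C -> C) (gamma : nat -> C),
     class_W1 f /\ log_coefficients f gamma /\
     Cmod (hankel_2_1 gamma) = 1 / 81).
Proof. exact (conj hankel_bound hankel_sharp). Qed.
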